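(* Fix a signature for trees consisting of the ancestor relation $\sqsubseteq$ and finitely many unary relations. For every monadic interpretation $\mathcal{I}_{MSO}$ (over this signature) there exist a monadic marking $\mathcal{M}_{MSO}$ and a first-order interpretation $\mathcal{I}_{FO}$ such that for every tree $t$, $\mathcal{I}_{MSO}(t)=\mathcal{I}_{FO}(\mathcal{M}_{MSO}(t))$.
   Context: A tree is a relational structure with one binary relation $\sqsubseteq$ (the ancestor relation) and unary label relations such that $\sqsubseteq$ is a partial order, has a minimal element (the root), and for every node $u$ the set $\{v: v\sqsubseteq u\}$ is well-ordered of order type at most $\omega$. Formulae may use the ancestor relation $\sqsubseteq$ (not merely a successor relation). An interpretation is a tuple $\mathcal{I}=(\delta(x),\phi_1(x_1,\dots,x_{r_1}),\dots,\phi_k(x_1,\dots,x_{r_k}))$ of formulae; applied to a structure $\mathcal{S}$ with universe $U$ it yields the structure $\mathcal{I}(\mathcal{S})$ with universe $\{u\in U:\mathcal{S}\models\delta(u)\}$ and whose $i$-th relation is the set of $r_i$-tuples from this universe satisfying $\phi_i$ in $\mathcal{S}$. It is first-order (resp. monadic) if all its formulae are first-order (resp. monadic second-order). A monadic marking is a monadic interpretation that keeps the universe and the original relations unchanged and adds new unary relations, each defined by a monadic formula with one free variable. *)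

(* Defs.v *)
(* MathComp world, with the classical sets of MathComp-Analysis. *)
From HB Require Import structures.
From mathcomp Require Import all_boot.
From mathcomp Require Import boolp classical_sets functions.

Set Implicit Arguments.
Unset Strict Implicit.
Unset Printing Implicit Defensive.

Local Open Scope classical_set_scope.

Record signature := Signature { sym : finType; arity : sym -> nat }.

(* The universe is a subset of an ambient type [T], so that an interpretation
   of a structure lives over the same [T] and [=] between two such
   interpretations means: same universe and same relations. *)
Record structure (sg : signature) (T : Type) := Structure {
  univ : set T;
  rel : forall R : sym sg, set ((arity R).-tuple T);
  rel_univ : forall (R : sym sg) (a : (arity R).-tuple T),
    rel a -> forall j, univ (tnth a j)
}.
Arguments univ {sg T} s.
Arguments rel {sg T} s R.

(* Monadic second-order formulae with [n] free first-order variables and [m]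
   free set variables, both as de Bruijn indices: a quantifier binds the
   variable of index 0 of its body and shifts the others by one.  The remaining
   connectives are definable, the semantics being classical. *)
Inductive formula (sg : signature) (n m : nat) : Type :=
| Atom (R : sym sg) of (arity R).-tuple 'I_n
| Equal of 'I_n & 'I_n
| Member of 'I_n & 'I_m
| Not of formula sg n m
| And of formula sg n m & formula sg n m
| Exists of formula sg n.+1 m
| ExistsSet of formula sg n m.+1.
Arguments Atom {sg n m} R _.
Arguments Equal {sg n m} _ _.
Arguments Member {sg n m} _ _.

Fixpoint first_order sg n m (phi : formula sg n m) : bool :=
  match phi with
  | Atom _ _ | Equal _ _ => true
  | Member _ _ => false
  | Not f => first_order f
  | And f g => first_order f && first_order g
  | Exists f => first_order f
  | ExistsSet _ => false
  end.

Fixpoint sat sg T (S : structure sg T) n m (phi : formula sg n m) :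
    n.-tuple T -> m.-tuple (set T) -> Prop :=
  match phi with
  | Atom R x => fun a A => rel S R (map_tuple (tnth a) x)
  | Equal x y => fun a A => tnth a x = tnth a y
  | Member x X => fun a A => tnth A X (tnth a x)
  | Not f => fun a A => ~ sat S f a A
  | And f g => fun a A => sat S f a A /\ sat S g a A
  | Exists f => fun a A =>
      exists u : T, univ S u /\ sat S f (cons_tuple u a) A
  | ExistsSet f => fun a A =>
      exists X : set T, X `<=` univ S /\ sat S f a (cons_tuple X A)
  end.

Record interpretation (sg tau : signature) := Interpretation {
  delta : formula sg 1 0;
  phi : forall R : sym tau, formula sg (arity R) 0
}.
Arguments delta {sg tau} i.
Arguments phi {sg tau} i R.

Definition fo_interpretation sg tau (I : interpretation sg tau) : Prop :=
  first_order (delta I) /\ forall R, first_order (phi I R).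

Section Interp.
Variables (sg tau : signature) (I : interpretation sg tau).
Variables (T : Type) (S : structure sg T).

Definition interp_univ : set T :=
  [set u | univ S u /\ sat S (delta I) [tuple u] [tuple]].

Definition interp_rel (R : sym tau) : set ((arity R).-tuple T) :=
  [set a | (forall j, interp_univ (tnth a j)) /\ sat S (phi I R) a [tuple]].

Lemma interp_rel_univ (R : sym tau) (a : (arity R).-tuple T) :
  interp_rel a -> forall j, interp_univ (tnth a j).
Proof. by case. Qed.

Definition interp : structure tau T := Structure interp_rel_univ.

End Interp.

(* [inl R] are the symbols of [sg], [inr l] the new unary ones. *)
Definition mark_sig (sg : signature) (L : finType) : signature :=
  @Signature (sym sg + L)%type
    (fun R => match R with inl R => arity R | inr _ => 1 end).

(* The new unary relations are unconstrained: they are defined by the formulae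
   [phi M (inr l)], of type [formula sg 1 0]. *)
Definition marking sg (L : finType) (M : interpretation sg (mark_sig sg L)) :
    Prop :=
  forall (T : Type) (S : structure sg T),
    univ (interp M S) = univ S /\
    forall R : sym sg, rel (interp M S) (inl R) = rel S R.

(* [None] is the ancestor relation, [Some l] a unary label. *)
Definition tree_sig (L : finType) : signature :=
  @Signature (option L) (fun R => if R is Some _ then 1 else 2).

Definition ancestor (L : finType) T (t : structure (tree_sig L) T) (u v : T) :
  Prop := rel t None [tuple u; v].

(* [A] ordered by [le] is isomorphic to an ordinal at most omega, that is, to
   an initial segment of [nat]. *)
Definition wo_type_le_omega T (le : T -> T -> Prop) (A : set T) : Prop :=
  exists (B : set nat) (f : T -> nat),
    [/\ forall i j, i <= j -> B j -> B i,
        set_bij A B f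
      & forall u v, A u -> A v -> (le u v <-> f u <= f v)].

Record tree (L : finType) T (t : structure (tree_sig L) T) : Prop := Tree {
  tree_refl : forall u, univ t u -> ancestor t u u;
  tree_antisym : forall u v, ancestor t u v -> ancestor t v u -> u = v;
  tree_trans : forall u v w,
    ancestor t u v -> ancestor t v w -> ancestor t u w;
  tree_root : exists2 r, univ t r & forall u, univ t u -> ancestor t r u;
  tree_wo : forall u, univ t u ->
    wo_type_le_omega (ancestor t) [set v | ancestor t v u]
}.

(* Main.v *)
(** A monadic formula is compiled, by induction, into a finite-valued map
    [theta] on the nodes of a tree with set parameters [A] (first-order variables
    being singletons): [theta t A u] only depends on the part of [A] below [u],
    and it is a function of the letter of [u] and of the values at the children of
    [u], counted up to a threshold.  Set quantification is the powerset
    construction.  For a formula with free nodes [x_1, .., x_n], the values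
    [theta t {} u] are marked.  The value of [theta t {x_1, .., x_n}] at a node
      [u]
    is then a first-order property: at the last common ancestor [v] of the [x_i],
    each child sees fewer points, and between [u] and [v] one evaluates a word
      over
    the finite set of one-step functions.

    The evaluation of these words is where marking beats plain first-order logic.
    Consider a deterministic complete automaton reading the branches downwards,
      and
    keep at each node a list of all its states, updated by taking the image of the
    list, deleting repetitions and appending the missing states.  The index of the
    current state of a run in the list never increases, so a run between two nodes
    is described by a bounded number of index drops. *)

Require Import Defs.
From mathcomp Require Import boolp classical_sets.
From mathcomp Require Import all_boot.

Set Implicit Arguments.
Unset Strict Implicit.
Unset Printing Implicit Defensive.

(** * Definable queries *)

Definition scons T (x : T) (e : nat -> T) (i : nat) : T :=
  if i is j.+1 then e j else x.

Definition env n T (e : nat -> T) : n.-tuple T := [tuple e i | i < n].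

Lemma tnth_env n T (e : nat -> T) (i : 'I_n) : tnth (env n e) i = e i.
Proof. by rewrite tnth_mktuple. Qed.

Lemma cons_env n T (x : T) (e : nat -> T) :
  cons_tuple x (env n e) = env n.+1 (scons x e).
Proof.
apply: eq_from_tnth => i; rewrite tnth_env.
by case: (unliftP ord0 i) => [j|] ->; rewrite ?tnth0 // tnthS tnth_env.
Qed.

Section Definability.
Variable L : finType.
Notation str := (structure (tree_sig L)).

Definition label T (t : str T) (l : L) (u : T) : Prop :=
  Defs.rel t (Some l) [tuple u].

(** Definability is handled semantically. Environments are total, and the number [n] of free
    variables enters only where queries are compared or classified. *)
Definition query :=
  forall T, str T -> (nat -> T) -> (nat -> set T) -> Prop.

Definition qequiv n (P Q : query) : Prop :=
  forall T (t : str T) e E, tree t -> (forall i, i < n -> univ t (e i)) ->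
  (P T t e E <-> Q T t e E).

(** The closure properties common to [mso m] and [fo_mso], so that the derived connectives are
    established once for both. *)
Record boolean_class (K : nat -> query -> Prop) : Prop := BooleanClass {
  cls_ext : forall n P Q, qequiv n P Q -> K n P -> K n Q;
  cls_eq : forall n i j, i < n -> j < n -> K n (fun T t e E => e i = e j);
  cls_anc : forall n i j, i < n -> j < n ->
    K n (fun T t e E => ancestor t (e i) (e j));
  cls_lab : forall n l i, i < n ->
    K n (fun T t e E => label t l (e i));
  cls_not : forall n P, K n P -> K n (fun T t e E => ~ P T t e E);
  cls_and : forall n P Q, K n P -> K n Q ->
    K n (fun T t e E => P T t e E /\ Q T t e E);
  cls_ex : forall n P, K n.+1 P ->
    K n (fun T t e E => exists u, univ t u /\ P T t (scons u e) E)
}.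

Section Derived.
Variables (K : nat -> query -> Prop) (HK : boolean_class K).

Lemma cls_true n : K n (fun _ _ _ _ => True).
Proof.
(* Truth is written as the existence of some [u = u], witnessed by the root. *)
apply: (cls_ext HK); last exact: (cls_ex HK (cls_eq HK (ltn0Sn n) (ltn0Sn n))).
move=> T t e E tt _; split=> // _.
by case: (tree_root tt) => r Ur _; exists r.
Qed.

Lemma cls_const n (b : Prop) : K n (fun _ _ _ _ => b).
Proof.
case: (pselect b) => Hb.
  by apply: (cls_ext HK) (cls_true n) => T t e E _ _; split.
by apply: (cls_ext HK) (cls_not HK (cls_true n)) => T t e E _ _; split=> //; case.
Qed.

Lemma cls_or n P Q : K n P -> K n Q ->
  K n (fun T t e E => P T t e E \/ Q T t e E).
Proof.
move=> HP HQ; apply: (cls_ext HK) (cls_not HK (cls_and HK (cls_not HK HP)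
  (cls_not HK HQ))) => T t e E _ _ /=; split; last by case=> ? [].
by move=> H; apply: contrapT => H'; apply: H; split=> ?; apply: H'; [left|right].
Qed.

Lemma cls_imp n P Q : K n P -> K n Q ->
  K n (fun T t e E => P T t e E -> Q T t e E).
Proof.
move=> HP HQ; apply: (cls_ext HK) (cls_or (cls_not HK HP) HQ) => T t e E _ _ /=.
split; first by case.
by move=> H; case: (pselect (P T t e E)) => ?; [right; apply: H | left].
Qed.

Lemma cls_iff n P Q : K n P -> K n Q ->
  K n (fun T t e E => P T t e E <-> Q T t e E).
Proof. by move=> HP HQ; apply: (cls_and HK) (cls_imp HP HQ) (cls_imp HQ HP). Qed.

Lemma cls_all n P : K n.+1 P ->
  K n (fun T t e E => forall u, univ t u -> P T t (scons u e) E).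
Proof.
move=> HP; apply: (cls_ext HK) (cls_not HK (cls_ex HK (cls_not HK HP))).
move=> T t e E _ _ /=; split; last by move=> H [u [Uu]]; apply; apply: H.
by move=> H u Uu; apply: contrapT => H'; apply: H; exists u.
Qed.

Lemma cls_allin n (I : eqType) (s : seq I) P : (forall i, K n (P i)) ->
  K n (fun T t e E => forall i, i \in s -> P i T t e E).
Proof.
move=> HP; elim: s => [|i s IH].
  by apply: (cls_ext HK) (cls_true n) => T t e E _ _; split.
apply: (cls_ext HK) (cls_and HK (HP i) IH) => T t e E _ _ /=; split.
  by case=> Hi Hs j; rewrite inE => /predU1P[->//|]; apply: Hs.
by move=> H; split=> [|j js]; apply: H; rewrite inE ?eqxx // js orbT.
Qed.

Lemma cls_fall n (I : finType) P : (forall i : I, K n (P i)) ->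
  K n (fun T t e E => forall i, P i T t e E).
Proof.
move=> HP; apply: (cls_ext HK) (cls_allin (enum I) HP) => T t e E _ _ /=.
by split=> H i; [apply: H; rewrite mem_enum | move=> _; apply: H].
Qed.

Lemma cls_fex n (I : finType) P : (forall i : I, K n (P i)) ->
  K n (fun T t e E => exists i, P i T t e E).
Proof.
move=> HP; apply: (cls_ext HK) (cls_not HK (cls_fall (fun i => cls_not HK (HP
  i)))).
move=> T t e E _ _ /=; split; last by move=> [i Pi] H; apply: (H i).
by move=> H; apply: contrapT => H'; apply: H => i Pi; apply: H'; exists i.
Qed.

End Derived.

Definition mso m n (P : query) : Prop :=
  exists f : formula (tree_sig L) n m,
  qequiv n (fun T t e E => sat t f (env n e) (env m E)) P.

Lemma mso_mem m n i j : i < n -> j < m -> mso m n (fun T t e E => E j (e i)).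
Proof.
move=> Hi Hj; exists (Member (Ordinal Hi) (Ordinal Hj)) => T t e E _ _ /=.
by rewrite !tnth_env.
Qed.

Lemma mso_boolean m : boolean_class (mso m).
Proof.
split.
- move=> n P Q PQ [f Hf]; exists f => T t e E tt Ht.
  by apply: iff_trans (PQ T t e E tt Ht); apply: Hf.
- move=> n i j Hi Hj; exists (Equal (Ordinal Hi) (Ordinal Hj)) => T t e E _ _ /=.
  by rewrite !tnth_env.
- move=> n i j Hi Hj.
  exists (@Atom (tree_sig L) n m None [tuple Ordinal Hi; Ordinal Hj]).
  move=> T t e E _ _ /=; rewrite /ancestor; set a := map_tuple _ _.
  suff -> : a = [tuple e i; e j] by [].
  by apply: val_inj; rewrite /= !tnth_env.
- move=> n l i Hi.
  exists (@Atom (tree_sig L) n m (Some l) [tuple Ordinal Hi]).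
  move=> T t e E _ _ /=; rewrite /label; set a := map_tuple _ _.
  suff -> : a = [tuple e i] by [].
  by apply: val_inj; rewrite /= !tnth_env.
- move=> n P [f Hf]; exists (Not f) => T t e E tt Ht /=.
  by move: (Hf T t e E tt Ht) => [? ?]; split=> H ?; apply: H; auto.
- move=> n P Q [f Hf] [g Hg]; exists (And f g) => T t e E tt Ht /=.
  by move: (Hf T t e E tt Ht) (Hg T t e E tt Ht) => [? ?] [? ?];
    split=> -[]; auto.
- move=> n P [f Hf]; exists (Exists f) => T t e E tt Ht /=.
  split=> -[u [Uu]] H; exists u; split=> //; move: H; rewrite cons_env;
    by apply Hf=> // -[|k] //= Hk; apply: Ht.
Qed.

Lemma mso_exset m n P : mso m.+1 n P ->
  mso m n (fun T t e E => exists X, (forall v, X v -> univ t v) /\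
                                    P T t e (scons X E)).
Proof.
move=> [f Hf]; exists (ExistsSet f) => T t e E tt Ht /=.
by split=> -[X [UX]] H; exists X; split=> //; move: H; rewrite cons_env;
  apply Hf.
Qed.

(** A block of [k] set quantifiers, used below for a fixed point with one set per element of a
    finite type. The old parameters move to the indices from [k] on. *)
Lemma mso_exsets k : forall m n P, mso (k + m) n P ->
  mso m n (fun T t e E => exists F : nat -> set T,
    (forall j v, F j v -> univ t v) /\
    P T t e (fun j => if j < k then F j else E (j - k))).
Proof.
elim: k => [|k IH] m n P HP.
  apply: (cls_ext (mso_boolean m)) HP => T t e E _ _ /=.
  have -> : (fun j => E (j - 0)) = E by apply/funext => j; rewrite subn0.
  by split=> [H|[F []]//]; exists (fun _ _ => False).
apply: (cls_ext (mso_boolean m)) (IH _ _ _ (mso_exset HP)) => T t e E _ _ /=.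
have eF F (X : set T) : scons X (fun j => if j < k then F j else E (j - k)) =
    (fun j => if j < k.+1 then scons X F j else E (j - k.+1)).
  by apply/funext => -[|j] //=; rewrite ltnS subSS.
split.
  move=> [F [UF [X [UX H]]]]; exists (scons X F); rewrite -eF; split=> //.
  by move=> [|j] v /=; [apply: UX | apply: UF].
move=> [F [UF H]]; exists (fun j => F j.+1); split=> [j v|]; first exact: UF.
exists (F 0); split; first exact: UF.
rewrite eF; suff -> : scons (F 0) (fun j => F j.+1) = F by [].
by apply/funext => -[].
Qed.

(* Stating definability in every context [m, n, i] replaces the substitution of
   variables in formulae. *)
Definition mso_unary (U : forall T, str T -> T -> Prop) : Prop :=
  forall m n i, i < n -> mso m n (fun T t e E => U T t (e i)).

(* First-order queries over unary monadic predicates; the set environment is only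
   carried along. *)
Inductive fo_mso : nat -> query -> Prop :=
| FoExt n P Q of qequiv n P Q & fo_mso n P : fo_mso n Q
| FoEq n i j of i < n & j < n : fo_mso n (fun T t e E => e i = e j)
| FoAnc n i j of i < n & j < n :
    fo_mso n (fun T t e E => ancestor t (e i) (e j))
| FoMark n i U of i < n & mso_unary U : fo_mso n (fun T t e E => U T t (e i))
| FoNot n P of fo_mso n P : fo_mso n (fun T t e E => ~ P T t e E)
| FoAnd n P Q of fo_mso n P & fo_mso n Q :
    fo_mso n (fun T t e E => P T t e E /\ Q T t e E)
| FoEx n P of fo_mso n.+1 P :
    fo_mso n (fun T t e E => exists u, univ t u /\ P T t (scons u e) E).

Lemma fo_mso_boolean : boolean_class fo_mso.
Proof.
split; try by econstructor; eauto.
move=> n l i Hi.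
apply: (FoMark (U := fun T t u => label t l u)) => //.
by move=> m k j Hj; apply: (cls_lab (mso_boolean m)).
Qed.

Lemma fo_mso_mso n P : fo_mso n P -> forall m, mso m n P.
Proof.
move=> H m; have B := mso_boolean m; elim: H => {n P}.
- by move=> n P Q PQ _; apply: (cls_ext B).
- exact: (cls_eq B).
- exact: (cls_anc B).
- by move=> n i U Hi HU; apply: HU.
- by move=> n P _; apply: (cls_not B).
- by move=> n P Q _ HP _; apply: (cls_and B).
- by move=> n P _; apply: (cls_ex B).
Qed.

(** Renaming of free variables, by induction on the derivation; under a quantifier the renaming
    fixes 0 and is shifted elsewhere. *)
Lemma fo_mso_reindex n P : fo_mso n P -> forall k (g : nat -> nat),
  (forall i, i < n -> g i < k) ->
  fo_mso k (fun T t e E => P T t (fun i => e (g i)) E).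
Proof.
elim=> {n P}.
- move=> n P Q PQ _ IH k g Hg; apply: FoExt (IH k g Hg) => T t e E tt Ht.
  by apply: PQ => // i Hi; apply/Ht/Hg.
- by move=> n i j Hi Hj k g Hg; apply: FoEq; apply: Hg.
- by move=> n i j Hi Hj k g Hg; apply: FoAnc; apply: Hg.
- by move=> n i U Hi HU k g Hg; apply: FoMark => //; apply: Hg.
- by move=> n P _ IH k g Hg; apply: FoNot; apply: IH.
- by move=> n P Q _ IH1 _ IH2 k g Hg; apply: FoAnd; [apply: IH1|apply: IH2].
- move=> n P _ IH k g Hg.
  have := IH k.+1 (fun i => if i is j.+1 then (g j).+1 else 0).
  move=> /(_ _)/FoEx H; apply: FoExt (H _); last by case.
  move=> T t e E _ _ /=.
  have eg u : (fun i => scons u e (if i is j.+1 then (g j).+1 else 0)) =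
    scons u (fun i => e (g i)) by apply/funext => -[].
  by split=> -[u [Uu H']]; exists u; split=> //; move: H'; rewrite eg.
Qed.

Lemma fo_mso_unary U : fo_mso 1 (fun T t e E => U T t (e 0)) -> mso_unary U.
Proof.
by move=> H m n i Hi; apply: (fo_mso_mso (fo_mso_reindex H (g := fun _ => i) _)).
Qed.

End Definability.

(** * Trees *)

Section Trees.
Variables (L : finType) (T : Type) (t : structure (tree_sig L) T).

Definition is_root (r : T) : Prop :=
  univ t r /\ forall u, univ t u -> ancestor t r u.

Definition strict_ancestor (u v : T) : Prop := ancestor t u v /\ u <> v.

Definition parent (p c : T) : Prop :=
  strict_ancestor p c /\
  forall w, univ t w -> strict_ancestor w c -> ancestor t w p.

Hypothesis tt : tree t.

Lemma anc_univl u v : ancestor t u v -> univ t u.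
Proof. by move=> /rel_univ /(_ ord0). Qed.

Lemma anc_univr u v : ancestor t u v -> univ t v.
Proof. by move=> /rel_univ /(_ ord_max). Qed.

Lemma parent_anc p c : parent p c -> ancestor t p c.
Proof. by case=> -[]. Qed.

Lemma child_root p c : parent p c -> ~ is_root c.
Proof.
move=> [[pc npc] _] [_ /(_ p (anc_univl pc)) cp].
exact: npc (tree_antisym tt pc cp).
Qed.

Lemma parent_uniq p p' c : parent p c -> parent p' c -> p = p'.
Proof.
move=> [pc Hp] [pc' Hp']; apply: (tree_antisym tt).
  by apply: Hp' => //; case: pc => /anc_univl.
by apply: Hp => //; case: pc' => /anc_univl.
Qed.

Lemma anc_total u v w : ancestor t v u -> ancestor t w u ->
  ancestor t v w \/ ancestor t w v.
Proof.
move=> vu wu; have [B [f [_ _ Hf]]] := tree_wo tt (anc_univr vu).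
by case/orP: (leq_total (f v) (f w)) => ?; [left|right]; apply/Hf.
Qed.

(** The ancestors of [c] are indexed by an initial segment of [nat], so the index just before that
    of [c] is attained, and it is attained by the parent. *)
Lemma parent_exists c : univ t c -> ~ is_root c -> exists p, parent p c.
Proof.
move=> Uc nrc; have [B [f [HB Bf Hf]]] := tree_wo tt Uc.
have [r Ur Hr] := tree_root tt.
have rc := Hr _ Uc; have cc := tree_refl tt Uc.
have injf v w : ancestor t v c -> ancestor t w c -> f v = f w -> v = w.
  by move=> vc wc E; apply: (tree_antisym tt); apply/Hf => //; rewrite E.
have nerc : r <> c by move=> E; apply: nrc; rewrite -E.
have fc : 0 < f c.
  rewrite lt0n; apply/eqP => f0; apply/nerc/injf => //.
  by have := (Hf r c rc cc).1 rc; rewrite f0 leqn0 => /eqP.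
case: Bf => Bf1 _ Bf3.
have [p pc fp] := Bf3 (f c).-1 (HB _ _ (leq_pred _) (Bf1 _ cc)).
exists p; split.
  by split=> // E; move: fp; rewrite E; case: (f c) fc => // k _ /= /esym;
    apply: n_Sn.
move=> w Uw [wc newc]; apply/Hf => //; rewrite fp -ltnS prednK //.
rewrite ltn_neqAle; apply/andP; split; last exact/Hf.
by apply/eqP => E; apply: newc; apply: injf.
Qed.

(** Induction down the branch from [u] to [v]. The measure is the position among the ancestors of
    [v], finite because their order type is at most omega. *)
Lemma path_ind u v (Q : T -> Prop) : ancestor t u v -> Q u ->
  (forall p c, ancestor t u p -> parent p c -> ancestor t c v -> Q p -> Q c) ->
  Q v.
Proof.
move=> uv Qu Qs; have [B [f [_ _ Hf]]] := tree_wo tt (anc_univr uv).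
have Hind n : forall x, f x < n -> ancestor t u x -> ancestor t x v -> Q x.
  elim: n => // n IH x fx ux xv.
  have [->//|neux] := pselect (x = u).
  have nrx : ~ is_root x.
    by move=> [_ /(_ u (anc_univl ux)) xu]; exact: neux (tree_antisym tt xu ux).
  have [p [[px nepx] Hp]] := parent_exists (anc_univr ux) nrx.
  have up : ancestor t u p.
    by apply: Hp; [apply: anc_univl ux | split=> // E; apply: neux].
  apply: (Qs p) => //; apply: IH => //; last exact: (tree_trans tt px xv).
  have pv := tree_trans tt px xv.
  rewrite -ltnS; apply: leq_trans fx; rewrite ltnS ltnNge; apply/negP => /Hf.
  by move=> /(_ xv pv) xp; exact: nepx (tree_antisym tt px xp).
exact: (Hind _ v (ltnSn _) uv (tree_refl tt (anc_univr uv))).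
Qed.

Lemma child_towards u v : strict_ancestor u v ->
  exists c, parent u c /\ ancestor t c v.
Proof.
move=> [uv neuv].
suff [E|//] : v = u \/ exists c, parent u c /\ ancestor t c v by case: neuv.
apply: (path_ind (Q := fun v => v = u \/ exists c, parent u c /\ ancestor t c
  v) uv); first by left.
move=> p c up pc _ [E|[c' [uc' c'p]]]; right.
  by exists c; split; [rewrite -E | apply: (tree_refl tt);
    exact: anc_univr (parent_anc pc)].
by exists c'; split=> //; apply: (tree_trans tt c'p); exact: parent_anc.
Qed.

(** Both children are ancestors of [v], hence comparable; were they distinct, the upper one would be
    an ancestor of [u], the parent of the lower one. *)
Lemma children_disjoint u c c' v : parent u c -> parent u c' ->
  ancestor t c v -> ancestor t c' v -> c = c'.
Proof.
wlog cc' : c c' / ancestor t c c'.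
  move=> H uc uc' cv c'v; case: (anc_total cv c'v) => ?; first exact: H.
  by symmetry; apply: H.
move=> [[uc neuc] _] [_ uc'] _ _; apply: contrapT => necc'; apply: neuc.
apply: (tree_antisym tt uc); apply: uc' => //; exact: anc_univr uc.
Qed.

End Trees.

(** * First-order definability of the basic tree relations *)

Section FoTrees.
Variable L : finType.
Notation fo_mso := (@fo_mso L).
Notation B := (@fo_mso_boolean L).

Lemma fo_mso_sanc n i j : i < n -> j < n ->
  fo_mso n (fun T t e E => strict_ancestor t (e i) (e j)).
Proof. by move=> ? ?; apply: FoAnd; [exact: FoAnc | apply/FoNot/FoEq]. Qed.

Lemma fo_mso_parent n i j : i < n -> j < n ->
  fo_mso n (fun T t e E => parent t (e i) (e j)).
Proof.
move=> ? ?; apply: FoAnd; first exact: fo_mso_sanc.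
apply: (cls_all B (P := fun T t e E => _ t (e 0) (e j.+1) -> _ t (e 0) (e i.+1))).
by apply: (cls_imp B); [apply: fo_mso_sanc | apply: FoAnc].
Qed.

Lemma fo_mso_root n i : i < n -> fo_mso n (fun T t e E => is_root t (e i)).
Proof.
move=> Hi; apply: FoAnd.
  (* Variables range over the universe, so this mark is equivalent to truth. *)
  by apply: (FoMark (U := fun T t u => univ t u)) => // m k j Hj;
     apply: (cls_ext (mso_boolean L m)) (cls_true (mso_boolean L m) k) => T t e
       E _ /(_ j Hj).
apply: (cls_all B (P := fun T t e E => _ t (e i.+1) (e 0))).
exact: FoAnc.
Qed.
End FoTrees.

(** * Sets of nodes with finitely many colours *)

(* Distinct elements spell the word [w], where [R k x] means: [x] has colour [k].
   Colours are thus counted up to a threshold by bounding the length of [w]. *)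
Fixpoint real T K (R : K -> T -> Prop) (w : seq K) : Prop :=
  if w is k :: w' then
    exists x, R k x /\ real (fun k' y => R k' y /\ y <> x) w'
  else True.

Definition color T K (C : T -> Prop) (chi : T -> K) (k : K) (x : T) : Prop :=
  C x /\ chi x = k.

Lemma eq_real T K (R R' : K -> T -> Prop) w :
  (forall k x, R k x <-> R' k x) -> real R w <-> real R' w.
Proof.
move=> E; suff -> : R = R' by [].
by apply/funext => k; apply/funext => x; apply/propext.
Qed.

(** The nested quantifiers of [real] pick the elements of [s] one at a time, each different from the
    earlier ones. The nested form is the first-order one; lists are easier to count with. *)
Lemma realP (T : eqType) K (chi : T -> K) w : forall C : T -> Prop,
  real (color C chi) w <->
  exists s, [/\ uniq s, forall x, x \in s -> C x & map chi s = w].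
Proof.
elim: w => [|k w IH] C /=.
  by split=> // _; exists [::].
have realD x : real (fun k' y => color C chi k' y /\ y <> x) w <->
    real (color (fun y => C y /\ y <> x) chi) w.
  by apply: eq_real => k' y; rewrite /color; split; [case=> -[]|case=> -[]].
split.
  move=> [x [[Cx <-]]] /(realD x).1 /IH [s [us Cs <-]]; exists (x :: s);
    split=> //=.
    by rewrite us andbT; apply/negP => /Cs [].
  by move=> y; rewrite inE => /predU1P[->//|/Cs []].
move=> [[|x s] [] //= /andP[xs us] Cs [<- Ew]]; exists x; split.
  by split=> //; apply: Cs; rewrite mem_head.
apply: (realD x).2; apply/IH; exists s; split=> // y ys; split;
  first by apply: Cs; rewrite inE ys orbT.
by move=> E; rewrite -E ys in xs.
Qed.

(** Equality of the number of elements of each colour, counted up to the threshold [N]. *)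
Definition sim T T' K N (C : T -> Prop) (chi : T -> K)
    (C' : T' -> Prop) (chi' : T' -> K) : Prop :=
  forall w, size w <= N -> (real (color C chi) w <-> real (color C' chi') w).

Lemma sim_sym T T' K N C (chi : T -> K) C' (chi' : T' -> K) :
  sim N C chi C' chi' -> sim N C' chi' C chi.
Proof. by move=> H w Hw; apply: iff_sym; apply: H. Qed.

Lemma sim_leq T T' K M N C (chi : T -> K) C' (chi' : T' -> K) :
  M <= N -> sim N C chi C' chi' -> sim M C chi C' chi'.
Proof. by move=> MN H w Hw; apply: H; apply: leq_trans MN. Qed.

Lemma real_comp T K K' (f : K -> K') C (chi : T -> K) w :
  real (color C (f \o chi)) w <->
  exists2 w', map f w' = w & real (color C chi) w'.
Proof.
(* [{classic T}] supplies the decidable equality required by [realP]. *)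
have P K0 (chi0 : T -> K0) := @realP {classic T} K0 chi0.
split; first move=> /P [s [us Cs <-]].
  by exists (map chi s); [rewrite -map_comp | apply/P; exists s].
by move=> [w' <-] /P [s [us Cs <-]]; apply/P; exists s; rewrite map_comp.
Qed.

Lemma sim_comp T T' K K' (f : K -> K') N C (chi : T -> K) C' (chi' : T' -> K) :
  sim N C chi C' chi' -> sim N C (f \o chi) C' (f \o chi').
Proof.
move=> H w Hw; rewrite !real_comp.
by split=> -[w' E Hr]; exists w' => //; apply/H => //; rewrite -(size_map f) E.
Qed.

Lemma sim_color T T' K N C (chi : T -> K) C' (chi' : T' -> K) x :
  0 < N -> sim N C chi C' chi' -> C x -> exists2 x', C' x' & chi' x' = chi x.
Proof.
move=> HN /(_ [:: chi x] HN) [H _] Cx.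
by case: H => [|x' [[]]]; [exists x | exists x'].
Qed.

(* The elements outside [a] have a frequent colour in the target, so that they can
   be sent one at a time to unused elements. *)
Lemma real_transfer (T T' K : eqType) N (chi : T -> K) C' (chi' : T' -> K)
    (a : pred T) (h0 : T -> T') (s : seq T) : uniq s -> size s <= N ->
  (forall x, x \in s -> a x -> C' (h0 x) /\ chi' (h0 x) = chi x) ->
  (forall x y, a x -> a y -> h0 x = h0 y -> x = y) ->
  (forall x, x \in s -> ~~ a x -> real (color C' chi') (nseq N (chi x))) ->
  real (color C' chi') (map chi s).
Proof.
move=> us Ns Ha Hinj Hna.
(* The map [h] extends [h0] from the elements in [a] to more and more of the others, listed in
   [r]. *)
suff H r : {subset r <= filter (predC a) s} -> uniq r -> exists h,
    {in filter a s ++ r &, injective h} /\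
    forall x, x \in filter a s ++ r -> C' (h x) /\ chi' (h x) = chi x.
  have [//||h [hinj hC]] := H (filter (predC a) s); first exact: filter_uniq.
  have ms x : (x \in s) = (x \in filter a s ++ filter (predC a) s).
    by rewrite mem_cat !mem_filter /= -andb_orl orbN.
  apply/realP; exists (map h s); split.
  - by rewrite map_inj_in_uniq // => x y; rewrite !ms; apply: hinj.
  - by move=> _ /mapP[x xs ->]; case: (hC x) => //; rewrite -ms.
  - by rewrite -map_comp; apply/eq_in_map => x xs; case: (hC x) => //=;
      rewrite -ms.
elim: r => [|x r IH] sr ur.
  exists h0; rewrite cats0; split=> [x y|x]; rewrite !mem_filter.
    by move=> /andP[ax _] /andP[ay _]; apply: Hinj.
  by move=> /andP[ax xs]; apply: Ha.
move: ur => /= /andP[xr ur].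
have [|//|h [hinj hC]] := IH; first by move=> y yr; apply: sr;
  rewrite inE yr orbT.
have := sr x; rewrite mem_head mem_filter => /(_ isT) /= /andP[nax xs].
have /realP [l [ul Cl El]] := Hna x xs nax.
have sl : size l = N by rewrite -(size_map chi') El size_nseq.
(* [l] has [N] elements, while [h] has used fewer than [size s <= N] values. *)
have [y yl yn] : exists2 y, y \in l & y \notin map h (filter a s ++ r).
  apply: contrapT => Hn; have : size l <= size (map h (filter a s ++ r)).
    apply: uniq_leq_size => // y yl; apply/negPn/negP => yn; apply: Hn.
    by exists y.
  rewrite sl size_map; apply/negP; rewrite -ltnNge; apply: leq_trans Ns.
  have : uniq (x :: filter a s ++ r).
    rewrite /= mem_cat negb_or xr mem_filter (negPf nax) /= cat_uniq
      filter_uniq //.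
    rewrite ur /= andbT; apply/hasPn => z zr; rewrite mem_filter.
    by have := sr z; rewrite inE zr orbT mem_filter => /(_ isT) /= /andP[/negPf
      ->].
  move/uniq_leq_size; apply => z; rewrite inE mem_cat !mem_filter.
  case/or3P=> [/eqP->//|/andP[]//|zr].
  by have := sr z; rewrite inE zr orbT mem_filter => /(_ isT) /= /andP[].
have cy : chi' y = chi x.
  have := map_f chi' yl; rewrite El; elim: (N) => //= n IHn.
  by rewrite inE => /predU1P[].
exists (fun z => if z == x then y else h z).
have mx z : (z \in filter a s ++ x :: r) = (z == x) || (z \in filter a s ++ r).
  by rewrite !mem_cat inE orbCA.
split=> [z1 z2|z]; rewrite !mx /=.
  case: eqP => [-> _|_ /= z1i]; case: eqP => [->//|_ /= z2i].
  - by move=> E; rewrite E map_f in yn.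
  - by move=> _ E; rewrite -E map_f in yn.
  - exact: hinj.
by case: eqP => [-> _|_ /=]; [split=> //; apply: Cl | apply: hC].
Qed.

(** Greedy choice of representatives: it stops at [N] elements, or earlier once [C] is exhausted. *)
Lemma saturated_list (T : eqType) (C : T -> Prop) N :
  exists s, [/\ uniq s, forall x, x \in s -> C x, size s <= N
    & size s = N \/ forall x, C x -> x \in s].
Proof.
elim: N => [|N [s [us Cs sN H]]]; first by exists [::]; split=> //; left.
case: H => [sE|H]; last by exists s; split=> //; [apply: leqW | right].
have [Hall|] := pselect (forall x, C x -> x \in s).
  by exists s; split=> //; [apply: leqW | right].
move=> /existsNP [x /not_implyP [Cx /negP xs]].
exists (x :: s); split=> /=; rewrite ?us ?xs ?sE //; last by left.
by move=> y; rewrite inE => /predU1P[->|/Cs].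
Qed.

(** The counting argument behind the powerset construction: a selection [f] of one element from each
    colour set is matched, up to [N], by a selection on the other side. The threshold leaves room
    for [N] representatives of every pair of a selected element and a colour set, plus one more
    element. *)
Lemma sim_choice_eq (Theta : finType) N (T T' : eqType) (x0 : T) (x0' : T')
    C (chi : T -> {set Theta}) C' (chi' : T' -> {set Theta}) (f : T -> Theta) :
  sim (N * #|{: Theta * {set Theta}}|).+1 C chi C' chi' ->
  (forall x, C x -> f x \in chi x) ->
  exists f', (forall x', C' x' -> f' x' \in chi' x') /\ sim N C f C' f'.
Proof.
set M := N * _ => HM Hf; pose g x := (f x, chi x).
have /choice [Dk HD] k := saturated_list (fun x => C x /\ g x = k) N.
(* [D] has all elements of rare colours and [N] elements of every other colour. An
   element of [C'] outside the copy of [D] can be given a frequent colour, because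
   [D] plus one element is still realised in [C]. *)
pose full k := size (Dk k) = N.
pose D := undup (flatten [seq Dk k | k <- enum {: Theta * {set Theta}}]).
have DkD k x : x \in Dk k -> x \in D.
  move=> xk; rewrite mem_undup; apply/flattenP; exists (Dk k) => //.
  by apply: map_f; rewrite mem_enum.
have DC x : x \in D -> C x.
  by rewrite mem_undup => /flattenP [_ /mapP[k _ ->]];
    have [_ H _ _] := HD k => /H[].
have nD x : C x -> x \notin D -> full (g x).
  move=> Cx xD; have [_ _ _ [//|H]] := HD (g x).
  by rewrite (DkD (g x)) // in xD; apply: H.
have uD : uniq D by exact: undup_uniq.
have sD : size D <= M.
  apply: leq_trans (size_undup _) _; rewrite /M cardE.
  elim: (enum _) => [|k l IH]; first by rewrite muln0.
  by rewrite /= size_cat mulnS leq_add //; have [] := HD k.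
(* The colours of [D] form a word short enough to be realised in [C'], which yields an injective
   copy of [D]. *)
have [h [hinj hC]] : exists h : T -> T', {in D &, injective h} /\
    forall x, x \in D -> C' (h x) /\ chi' (h x) = chi x.
  have [|H _] := HM (map chi D); first by rewrite size_map leqW.
  have /realP [D' [uD' CD' ED]] : real (color C' chi') (map chi D).
    by apply/H/realP; exists D.
  have sDD : size D' = size D by rewrite -(size_map chi' D') ED size_map.
  exists (fun x => nth x0' D' (index x D)); split=> [x y xD yD|x xD].
    move/eqP; rewrite nth_uniq ?sDD ?index_mem // => /eqP E.
    by rewrite -(nth_index x0 xD) E nth_index.
  split; first by apply: CD'; rewrite mem_nth // sDD index_mem.
  have xs := xD; rewrite -index_mem in xs.
  by rewrite -(nth_map _ (chi x0)) ?sDD // ED (nth_map x0) // nth_index.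
have fullP k : full k -> real (color C f) (nseq N k.1) /\
    (forall f', (forall x, x \in D -> f' (h x) = f x) ->
     real (color C' f') (nseq N k.1)).
  move=> Fk; have [us Cs _ _] := HD k.
  have nseqE (S : eqType) (F : S -> Theta) (l : seq S) n : size l = n ->
    (forall x, x \in l -> F x = k.1) -> map F l = nseq n k.1.
    move=> <-; elim: l => //= x l IH Hl.
    rewrite Hl ?mem_head // IH // => y yl; apply: Hl.
    by rewrite inE yl orbT.
  split; first apply/realP.
    exists (Dk k); split=> // [x /Cs[]//|].
    by apply: nseqE => // x /Cs [_ <-].
  move=> f' Hf'; apply/realP; exists (map h (Dk k)); split.
  - by rewrite map_inj_in_uniq // => x y /DkD ? /DkD ?; apply: hinj.
  - by move=> _ /mapP[x /DkD /hC [? _] ->].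
  - apply: nseqE; first by rewrite size_map.
    by move=> _ /mapP[x xk ->]; rewrite Hf' ?(DkD k) //; have [_ <-] := Cs x xk.
(* On the copy of [D] the selection is carried over by [h]; elsewhere it is any selection giving a
   full pair. *)
have /choice [f' Hf'] (x' : T') : exists theta, C' x' ->
    theta \in chi' x' /\ ((exists x, [/\ x \in D, x' = h x & theta = f x]) \/
    x' \notin map h D /\ full (theta, chi' x')).
  have [Cx'|nC] := pselect (C' x'); last by exists (f x0) => /nC.
  have [/mapP[x xD ->]|xD] := boolP (x' \in map h D).
    exists (f x) => _; split; last by left; exists x.
    by have [_ ->] := hC x xD; apply/Hf/DC.
  have [] := HM (chi' x' :: map chi D); first by rewrite /= size_map.
  move=> _ []; first apply/realP.
    exists (x' :: map h D); split=> /=.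
    - by rewrite xD map_inj_in_uniq.
    - by move=> y; rewrite inE => /predU1P[->//|/mapP[x /hC [? _] ->]].
    - congr cons; rewrite -map_comp; apply/eq_in_map => x xE /=.
      by have [] := hC x xE.
  move=> x1 Hx1; have /realP [E [uE CE EE]] :
    real (color C chi) (chi' x' :: map chi D) by exists x1.
  (* The colour of [x'] occurs once more in [E] than in [D], so some element of [E] with this colour
     lies outside [D]. *)
  have [x xE [xD' cx]] : exists2 x, x \in E & x \notin D /\ chi x = chi' x'.
    apply: contrapT => Hn; set P := chi' x'.
    have : count (preim chi (pred1 P)) E <= count (preim chi (pred1 P)) D.
      rewrite -!size_filter; apply: uniq_leq_size; first exact: filter_uniq.
      move=> x; rewrite !mem_filter => /andP[/= /eqP cx xE]; rewrite cx eqxx /=.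
      by apply/negPn/negP => xD'; apply: Hn; exists x.
    by rewrite -!count_map EE /= eqxx ltnn.
  exists (f x) => _; rewrite -cx; split; first exact/Hf/CE.
  by right; split=> //; apply: nD => //; apply: CE.
exists f'; split=> [x' /Hf' []//|].
have f'h x : x \in D -> f' (h x) = f x.
  move=> xD; have [Cx _] := hC x xD; have [_ [[y [yD E ->]]|[]]] := Hf' _ Cx.
    by rewrite (hinj x y).
  by rewrite map_f.
move=> w Hw; split=> /realP [s [us Cs Ew]];
  rewrite -Ew size_map in Hw *.
  apply: (real_transfer (N := N) (a := fun x => x \in D) (h0 := h)) => //.
  - by move=> x xs xD; split; [have [] := hC x xD | exact: f'h].
  - by move=> x xs xnD; apply: (fullP _ (nD x (Cs x xs) xnD)).2.
(* For the converse transfer, [k] inverts [h] on its image. *)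
pose k x' := nth x0 D (index x' (map h D)).
have kP x' : x' \in map h D -> k x' \in D /\ h (k x') = x'.
  move=> x'D; have x's := x'D; rewrite -index_mem size_map in x's.
  by rewrite /k mem_nth // -(nth_map _ x0') // nth_index.
apply: (real_transfer (N := N) (a := fun x => x \in map h D) (h0 := k)) => //.
- move=> x' xs /kP [kD hk]; split; first exact: DC.
  by rewrite -f'h // hk.
- by move=> x y /kP [_ {2}<-] /kP [_ {2}<-] ->.
- move=> x' xs xnD; have [_ [[x [xD E _]]|[_ H]]] := Hf' x' (Cs _ xs).
    by rewrite E map_f in xnD.
  by have [] := fullP _ H.
Qed.

Definition choice_bound (Theta : finType) (N : nat) : nat :=
  (N * #|{: Theta * {set Theta}}|).+1.

Lemma sim_choice (Theta : finType) N T T' (x0 : T) (x0' : T')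
    C (chi : T -> {set Theta}) C' (chi' : T' -> {set Theta}) (f : T -> Theta) :
  sim (choice_bound Theta N) C chi C' chi' ->
  (forall x, C x -> f x \in chi x) ->
  exists f', (forall x', C' x' -> f' x' \in chi' x') /\ sim N C f C' f'.
Proof. exact: (@sim_choice_eq _ _ {classic T} {classic T'}). Qed.

(** * Compositional maps *)

Section Invariants.
Variable L : finType.
Notation str := (structure (tree_sig L)).

Definition same_letter V T (t : str T) (A : V -> set T) u
    T' (t' : str T') (A' : V -> set T') u' : Prop :=
  (forall l, label t l u <-> label t' l u') /\ forall i, A i u <-> A' i u'.

Lemma same_letter_sym V T (t : str T) (A : V -> set T) u
    T' (t' : str T') (A' : V -> set T') u' :
  same_letter t A u t' A' u' -> same_letter t' A' u' t A u.
Proof. by move=> [H1 H2]; split=> ?; apply: iff_sym. Qed.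

(** A bottom-up tree automaton in semantic form. Branches may be infinite, so [icomp] cannot serve
    as a recursive definition: the values are given outright, and [idef] records their definability
    separately. *)
Record compositional (V : Type) := Compositional {
  itype : finType;
  ifun : forall T, str T -> (V -> set T) -> T -> itype;
  ibound : nat;
  ilocal : forall T (t : str T) A A' u, tree t ->
    (forall v, ancestor t u v -> forall i, A i v <-> A' i v) ->
    ifun t A u = ifun t A' u;
  icomp : forall T (t : str T) A u T' (t' : str T') A' u', tree t -> tree t' ->
    univ t u -> univ t' u' -> same_letter t A u t' A' u' ->
    sim ibound (parent t u) (ifun t A) (parent t' u') (ifun t' A') ->
    ifun t A u = ifun t' A' u';
  idef : forall c m n i g, i < n -> (forall v, g v < m) ->
    mso m n (fun T t e E => ifun t (fun v => E (g v)) (e i) = c)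
}.

Definition recognizable V (P : forall T, str T -> (V -> set T) -> Prop) : Prop :=
  exists (I : compositional V) (acc : pred (itype I)),
  forall T (t : str T) A r, tree t -> is_root t r ->
  (P T t A <-> acc (ifun I t A r)).

Lemma rec_ext V (P Q : forall T, str T -> (V -> set T) -> Prop) :
  (forall T (t : str T) A, tree t -> (P T t A <-> Q T t A)) ->
  recognizable P -> recognizable Q.
Proof.
move=> E [I [acc H]]; exists I, acc => T t A r tt rr.
by apply: iff_trans (H _ _ _ _ tt rr); apply: iff_sym; apply: E.
Qed.

Lemma rec_not V (P : forall T, str T -> (V -> set T) -> Prop) :
  recognizable P -> recognizable (fun T t A => ~ P T t A).
Proof.
move=> [I [acc H]]; exists I, (predC acc) => T t A r tt rr /=.
have [H1 H2] := H _ _ A _ tt rr.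
by split=> [H'|/negP H' /H1 //]; apply/negP => /H2.
Qed.

Lemma prod_invariant_comp V (I J : compositional V) T (t : str T) A u
    T' (t' : str T') A' u' :
  let th T t (A : V -> set T) u := (ifun I t A u, ifun J t A u) in
  tree t -> tree t' -> univ t u -> univ t' u' -> same_letter t A u t' A' u' ->
  sim (maxn (ibound I) (ibound J)) (parent t u) (th T t A)
    (parent t' u') (th T' t' A') ->
  th T t A u = th T' t' A' u'.
Proof.
move=> th t1 t2 Uu Uu' Hl Hs; congr pair; apply: icomp => //.
  exact: (sim_comp fst (sim_leq (leq_maxl _ _) Hs)).
exact: (sim_comp snd (sim_leq (leq_maxr _ _) Hs)).
Qed.

Definition prod_invariant V (I J : compositional V) : compositional V.
Proof.
apply: (Compositional _ (@prod_invariant_comp V I J)).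
- by move=> T t A A' u tt H; congr pair; apply: ilocal.
- move=> [c d] m n i g Hi Hg.
  apply: (cls_ext (mso_boolean L m)) (cls_and (mso_boolean L m)
    (@idef _ I c m n i g Hi Hg) (@idef _ J d m n i g Hi Hg)) => T t e E _ _ /=.
  by split=> [[-> ->]|[-> ->]].
Defined.

Lemma rec_and V (P Q : forall T, str T -> (V -> set T) -> Prop) :
  recognizable P -> recognizable Q -> recognizable (fun T t A => P T t A /\ Q T
    t A).
Proof.
move=> [I [a Ha]] [J [b Hb]].
exists (prod_invariant I J), (fun c => a c.1 && b c.2) => T t A r tt rr /=.
have [? ?] := Ha _ _ A _ tt rr; have [? ?] := Hb _ _ A _ tt rr.
by split=> [[? ?]|/andP[]]; [apply/andP|]; auto.
Qed.

Definition reindex_invariant V W (h : V -> W) (I : compositional V) :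
  compositional W.
Proof.
apply: (@Compositional W (itype I) (fun T t A u => ifun I t (fun v => A (h v)) u)
  (ibound I)).
- by move=> T t A A' u tt H; apply: ilocal => // v uv i; apply: H.
- move=> T t A u T' t' A' u' t1 t2 Uu Uu' [Hl HA] Hs.
  by apply: icomp => //; split=> // i; apply: HA.
- by move=> c m n i g Hi Hg; apply: (@idef _ I c m n i (fun v => g (h v))).
Defined.

Lemma rec_reindex V W (h : V -> W) (P : forall T, str T -> (V -> set T) -> Prop) :
  recognizable P -> recognizable (fun T t A => P T t (fun v => A (h v))).
Proof.
by move=> [I [a Ha]]; exists (reindex_invariant h I), a => T t A r tt rr;
  apply: Ha.
Qed.

(** * Set quantification *)

Definition ocons V T (X : set T) (A : V -> set T) (o : option V) : set T :=
  if o is Some v then A v else X.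

Definition set_types V (I : compositional (option V)) T (t : str T) A u
    : {set itype I} :=
  [set c | `[< exists X : set T, (forall v, X v -> univ t v) /\
                 ifun I t (ocons X A) u = c >]].

Lemma set_typesP V (I : compositional (option V)) T (t : str T) A u c :
  c \in set_types I t A u <-> exists X : set T, (forall v, X v -> univ t v) /\
                 ifun I t (ocons X A) u = c.
Proof. by rewrite inE; split=> [/asboolP|H]; last exact/asboolP. Qed.

(** A set [X] gives each child of [u] a value. By [sim_choice], matching values can be selected at
    the children of [u'], each attained by some set; these sets are glued along the disjoint
    subtrees. *)
Lemma set_types_sub V (I : compositional (option V)) T (t : str T) A u
    T' (t' : str T') A' u' :
  tree t -> tree t' -> univ t u -> univ t' u' -> same_letter t A u t' A' u' ->
  sim (choice_bound (itype I) (ibound I)) (parent t u) (set_types I t A)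
    (parent t' u') (set_types I t' A') ->
  {subset set_types I t A u <= set_types I t' A' u'}.
Proof.
move=> t1 t2 Uu Uu' [Hl HA] Hs c /set_typesP [X [UX <-]].
have [|f' [Hf' Hs']] := sim_choice u u' (f := ifun I t (ocons X A)) Hs.
  by move=> v _; apply/set_typesP; exists X.
have /choice [Y HY] c' : exists Y : set T', parent t' u' c' ->
    (forall v, Y v -> univ t' v) /\ ifun I t' (ocons Y A') c' = f' c'.
  have [Pc'|nP] := pselect (parent t' u' c');
    last by exists (fun _ => False) => /nP.
  by have /set_typesP [Y ?] := Hf' _ Pc'; exists Y.
(* The glued set: [u'] is treated like [u], and below each child [c'] the set [Y c'] is used. *)
pose X' v := (v = u' /\ X u) \/ exists c', [/\ parent t' u' c',
  ancestor t' c' v & Y c' v].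
apply/set_typesP; exists X'; split.
  by move=> v [[-> _]//|[c' [_ c'v _]]]; apply: anc_univr c'v.
symmetry; apply: icomp => //.
  split=> // -[i|] /=; first exact: HA.
  split=> [Xu|[[]//|[c' [/[dup] Pc' [[u'c' ne] _] c'u' _]]]]; first by left.
  by case: ne; apply: (tree_antisym t2).
move=> w Hw; apply: (iff_trans (Hs' w Hw)); apply: eq_real => k c'.
(* By locality only the part of [X'] below [c'] matters, and there it coincides with [Y c']. *)
suff E : parent t' u' c' -> ifun I t' (ocons X' A') c' = f' c'.
  by split=> -[Pc' <-]; split=> //; rewrite E.
move=> Pc'; have [_ <-] := HY c' Pc'; apply: ilocal => // v c'v [i|] //=.
split=> [[[E _]|[c2 [Pc2 c2v]]]|HYv].
- case: Pc' => -[u'c' ne] _; case: ne; apply: (tree_antisym t2) => //.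
  by rewrite -E.
- by rewrite (children_disjoint t2 Pc2 Pc' c2v c'v).
- by right; exists c'.
Qed.

Definition exset_invariant V (I : compositional (option V)) : compositional V.
Proof.
apply: (@Compositional V {set itype I} (@set_types V I)
  (choice_bound (itype I) (ibound I))).
- move=> T t A A' u tt H; apply/setP => c;
    apply/idP/idP => /set_typesP [X [UX E]];
    apply/set_typesP; exists X; split=> //; rewrite -E;
      apply: ilocal => // v uv [i|] //=;
    [apply: iff_sym|]; exact: H.
- move=> T t A u T' t' A' u' t1 t2 Uu Uu' Hl Hs; apply/eqP;
    rewrite finset.eqEsubset.
  apply/andP; split; apply/subsetP; apply: set_types_sub => //.
    exact: same_letter_sym.
  exact: sim_sym.
- move=> c m n i g Hi Hg; have B := mso_boolean L m.
  pose g' (o : option V) := if o is Some v then (g v).+1 else 0.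
  have Hd d := @mso_exset _ _ _ _ (@idef _ I d m.+1 n i g' Hi (fun o =>
    match o with Some v => Hg v | None => isT end)).
  apply: (cls_ext B) (cls_fall B (fun d => cls_iff B (Hd d) (cls_const B n (d
    \in c)))).
  move=> T t e E _ _ /=.
  have eg X : (fun o => scons X E (g' o)) = ocons X (fun v => E (g v)).
    by apply/funext => -[].
  split=> [H|<- d].
    apply/setP => d; apply/idP/idP; rewrite set_typesP => Hx.
      by apply/H; case: Hx => X HX; exists X; rewrite eg.
    by case/H: Hx => X; rewrite eg => HX; exists X.
  by rewrite set_typesP; split=> -[X]; rewrite ?eg => HX; exists X; rewrite ?eg.
Defined.

Lemma rec_exset V (P : forall T, str T -> (option V -> set T) -> Prop) :
  recognizable P ->
  recognizable (fun T t A => exists X : set T, (forall v, X v -> univ t v) /\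
                                P T t (ocons X A)).
Proof.
move=> [I [a Ha]]; exists (exset_invariant I), (fun c : {set itype I} =>
  [exists d in c, a d]).
move=> T t A r tt rr /=; split.
  move=> [X [UX /(Ha _ _ _ _ tt rr) H]]; apply/existsP.
  exists (ifun I t (ocons X A) r); rewrite H andbT.
  by apply/set_typesP; exists X.
move=> /existsP [d /andP[/set_typesP [X [UX <-]] H]]; exists X; split=> //.
exact/(Ha _ _ _ _ tt rr).
Qed.

(** * Atomic properties: nodes and comparable pairs with given letters *)

Definition letter_query V (q : forall T, str T -> (V -> set T) -> T -> Prop) :=
  (forall T (t : str T) A u T' (t' : str T') A' u',
    same_letter t A u t' A' u' -> q T t A u -> q T' t' A' u') /\
  forall m n i g, i < n -> (forall v, g v < m) ->
    mso m n (fun T t e E => q T t (fun v => E (g v)) (e i)).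

Section Pairs.
Variables (V : Type) (q1 q2 : forall T, str T -> (V -> set T) -> T -> Prop).
Hypotheses (Hq1 : letter_query q1) (Hq2 : letter_query q2).

Definition has_pair T (t : str T) A u : Prop :=
  exists v w, [/\ ancestor t u v, ancestor t v w, q1 t A v & q2 t A w].
Definition has_lower T (t : str T) A u : Prop :=
  exists w, ancestor t u w /\ q2 t A w.
Definition pair_type T (t : str T) A u : bool * bool :=
  (`[< has_pair t A u >], `[< has_lower t A u >]).

(** A pair either starts at the node itself, which calls for the second bit, or lies below one
    child. A single child has to be matched each time, so the threshold 1 suffices. *)
Lemma pair_type_sub T (t : str T) A u T' (t' : str T') A' u' :
  tree t -> tree t' -> univ t' u' -> same_letter t A u t' A' u' ->
  sim 1 (parent t u) (pair_type t A) (parent t' u') (pair_type t' A') ->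
  (has_lower t A u -> has_lower t' A' u') /\ (has_pair t A u -> has_pair t' A'
    u').
Proof.
move=> t1 t2 Uu' Hl Hs; have rfl := tree_refl t2 Uu'.
have Hlow : has_lower t A u -> has_lower t' A' u'.
  move=> [w [uw q2w]]; have [E|ne] := pselect (u = w).
    by exists u'; split=> //; apply: (Hq2.1 _ _ _ _ _ _ _ _ Hl); rewrite E.
  have [c [Pc cw]] := child_towards t1 (conj uw ne).
  have [c' Pc' [_ E]] := sim_color (ltn0Sn 0) Hs Pc.
  have : has_lower t' A' c'.
    by apply/asboolP; rewrite E; apply/asboolP; exists w.
  move=> [w' [c'w' ?]]; exists w'; split=> //.
  exact: (tree_trans t2 (parent_anc Pc') c'w').
split=> // -[v [w [uv vw q1v q2w]]]; have [E|ne] := pselect (u = v).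
  have [|w' [u'w' q2w']] := Hlow; first by exists w; rewrite E.
  by exists u', w'; split=> //; apply: (Hq1.1 _ _ _ _ _ _ _ _ Hl); rewrite E.
have [c [Pc cv]] := child_towards t1 (conj uv ne).
have [c' Pc' [E _]] := sim_color (ltn0Sn 0) Hs Pc.
have : has_pair t' A' c'.
  by apply/asboolP; rewrite E; apply/asboolP; exists v, w.
move=> [v' [w' [c'v' ? ? ?]]]; exists v', w'; split=> //.
exact: (tree_trans t2 (parent_anc Pc') c'v').
Qed.

Lemma letter_query_local q T (t : str T) A A' v : letter_query (V := V) q ->
  (forall i, A i v <-> A' i v) -> q T t A v -> q T t A' v.
Proof. by move=> Hq H; apply: Hq.1. Qed.

Definition pair_invariant : compositional V.
Proof.
apply: (@Compositional V (bool * bool)%type pair_type 1).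
- move=> T t A A' u tt H; congr pair; apply: asbool_equiv_eq; split.
  + move=> [v [w [uv vw ? ?]]]; exists v, w; have uw := tree_trans tt uv vw.
    by split=> //; [apply: letter_query_local (H v uv) _|
                    apply: letter_query_local (H w uw) _].
  + move=> [v [w [uv vw ? ?]]]; exists v, w; have uw := tree_trans tt uv vw.
    by split=> //; [apply: letter_query_local (fun i => iff_sym (H v uv i)) _|
                    apply: letter_query_local (fun i => iff_sym (H w uw i)) _].
  + by move=> [w [uw ?]]; exists w; split=> //;
    apply: letter_query_local (H w uw) _.
  + by move=> [w [uw ?]]; exists w; split=> //;
      apply: letter_query_local (fun i => iff_sym (H w uw i)) _.
- move=> T t A u T' t' A' u' t1 t2 Uu Uu' Hl Hs.
  have [? ?] := pair_type_sub t1 t2 Uu' Hl Hs.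
  have [? ?] := pair_type_sub t2 t1 Uu (same_letter_sym Hl) (sim_sym Hs).
  by congr pair; apply: asbool_equiv_eq; split.
- move=> [b1 b2] m n i g Hi Hg; have B := mso_boolean L m.
  have D1 : mso m n (fun T t e E => has_pair t (fun v => E (g v)) (e i)).
    apply: (cls_ext B) (cls_ex B (cls_ex B (cls_and B
      (cls_and B (@cls_anc _ _ B n.+2 i.+2 1 _ _) (@cls_anc _ _ B n.+2 1 0 _ _))
      (cls_and B (Hq1.2 m n.+2 1 g _ _) (Hq2.2 m n.+2 0 g _ _))))) => //.
    move=> T t e E _ _ /=; split.
      by move=> [v [_ [w [_ [[? ?] [? ?]]]]]]; exists v, w.
    move=> [v [w [uv vw ? ?]]]; exists v; split; first exact: anc_univr uv.
    by exists w; split; first exact: anc_univr vw.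
  have D2 : mso m n (fun T t e E => has_lower t (fun v => E (g v)) (e i)).
    apply: (cls_ext B) (cls_ex B (cls_and B (@cls_anc _ _ B n.+1 i.+1 0 _ _)
      (Hq2.2 m n.+1 0 g _ _))) => //.
    move=> T t e E _ _ /=; split; first by move=> [w [_ ?]]; exists w.
    by move=> [w [uw ?]]; exists w; split; first exact: anc_univr uw.
  apply: (cls_ext B) (cls_and B (cls_iff B D1 (cls_const B n b1))
    (cls_iff B D2 (cls_const B n b2))) => T t e E _ _ /=.
  have asE (Q : Prop) (b : bool) : (Q <-> b) <-> `[< Q >] = b.
    split=> [H|<-]; last by split=> /asboolP.
    by rewrite (asbool_equiv_eq H); apply/idP/idP => [/asboolP|?];
      last exact/asboolP.
  by rewrite /pair_type; split=> [[/asE -> /asE ->]|[/asE ? /asE ?]].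
Defined.

Lemma rec_pair : recognizable (fun T t A =>
  exists v w, [/\ ancestor t v w, q1 t A v & q2 t A w]).
Proof.
exists pair_invariant, fst => T t A r tt [Ur Hr] /=; split.
  move=> [v [w [vw ? ?]]]; apply/asboolP; exists v, w; split=> //.
  by apply: Hr; apply: anc_univl vw.
by move=> /asboolP [v [w [_ ? ? ?]]]; exists v, w.
Qed.

End Pairs.

Lemma rec_node V (q : forall T, str T -> (V -> set T) -> T -> Prop) :
  letter_query q -> recognizable (fun T t A => exists u, univ t u /\ q T t A u).
Proof.
move=> Hq; apply: rec_ext (rec_pair Hq Hq) => T t A tt; split.
  by move=> [v [w [vw ? _]]]; exists v; split=> //; apply: anc_univl vw.
by move=> [v [Uv ?]]; exists v, v; split=> //; apply: tree_refl.
Qed.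

Lemma letter_mem V (i : V) : letter_query (fun T t A u => A i u).
Proof.
split=> [T t A u T' t' A' u' [_ H]|m n j g Hj Hg]; first by apply: (H i).1.
exact: mso_mem.
Qed.

Lemma letter_label V l :
  letter_query (fun T t (A : V -> set T) u => label t l u).
Proof.
split=> [T t A u T' t' A' u' [H _]|m n j g Hj Hg]; first by apply: (H l).1.
exact: (cls_lab (mso_boolean L m)).
Qed.

Lemma letter_not V (q : forall T, str T -> (V -> set T) -> T -> Prop) :
  letter_query q -> letter_query (fun T t A u => ~ q T t A u).
Proof.
move=> [H1 H2]; split.
  by move=> T t A u T' t' A' u' E nq Hq; apply/nq/(H1 _ _ _ _ _ _ _ _
    (same_letter_sym E)).
by move=> m n j g Hj Hg; apply/(cls_not (mso_boolean L m))/H2.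
Qed.

Lemma letter_and V (q q' : forall T, str T -> (V -> set T) -> T -> Prop) :
  letter_query q -> letter_query q' ->
  letter_query (fun T t A u => q T t A u /\ q' T t A u).
Proof.
move=> [H1 H2] [H3 H4]; split.
  by move=> T t A u T' t' A' u' E [? ?]; split; [apply: H1 E _|apply: H3 E _].
by move=> m n j g Hj Hg; apply: (cls_and (mso_boolean L m));
  [apply: H2|apply: H4].
Qed.

End Invariants.

(** * Monadic formulae are recognizable *)

Section Formulas.
Variable L : finType.
Notation str := (structure (tree_sig L)).

(** A singleton is a nonempty set that no set splits; in this form the closure properties above
    apply. *)
Lemma rec_singleton V (i : V) : @recognizable L V (fun T t A =>
  (exists u, univ t u /\ A i u) /\
  ~ exists X : set T, (forall v, X v -> univ t v) /\
      ((exists u, univ t u /\ (X u /\ A i u)) /\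
       (exists u, univ t u /\ (~ X u /\ A i u)))).
Proof.
apply: rec_and; first by apply: rec_node; apply: letter_mem.
pose P T (t : str T) (A : option V -> set T) :=
  (exists u, univ t u /\ (A None u /\ A (Some i) u)) /\
  (exists u, univ t u /\ (~ A None u /\ A (Some i) u)).
apply: rec_not; apply: (rec_exset (P := P)); apply: rec_and; apply: rec_node;
  apply: letter_and; try exact: letter_mem.
by apply: letter_not; apply: letter_mem.
Qed.

Lemma singletonP (T : Type) (t : str T) (X : set T) : (forall v, X v -> univ t
  v) ->
  ((exists u, univ t u /\ X u) /\
   ~ exists Y : set T, (forall v, Y v -> univ t v) /\
      ((exists u, univ t u /\ (Y u /\ X u)) /\
       (exists u, univ t u /\ (~ Y u /\ X u)))) <->
  exists x, univ t x /\ X = (fun v => v = x).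
Proof.
move=> UX; split.
  move=> [[x [Ux Xx]] H]; exists x; split=> //; apply/funext => v; apply/propext.
  split=> [Xv|->//]; apply: contrapT => ne; apply: H; exists (fun v => v = x).
  split; first by move=> ? ->.
  by split; [exists x | exists v; split=> //; apply: UX].
move=> [x [Ux ->]]; split; first by exists x.
by move=> [Y [_ [[u [_ [Yu E]]] [v [_ [nY E']]]]]]; apply: nY; rewrite E' -E.
Qed.

Definition valuation n m T (a : n.-tuple T) (A : m.-tuple (set T))
    (s : 'I_n + 'I_m) : set T :=
  match s with inl i => fun v => v = tnth a i | inr j => tnth A j end.

(** The newly bound variable, of index 0, goes to [None], the slot that [ocons] fills. *)
Definition unlift_inl n m (s : 'I_n.+1 + 'I_m) : option ('I_n + 'I_m) :=
  match s with
  | inl i => if unlift ord0 i is Some j then Some (inl j) else None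
  | inr j => Some (inr j)
  end.

Definition unlift_inr n m (s : 'I_n + 'I_m.+1) : option ('I_n + 'I_m) :=
  match s with
  | inl i => Some (inl i)
  | inr j => if unlift ord0 j is Some k then Some (inr k) else None
  end.

Lemma valuation_inl n m T (x : T) (a : n.-tuple T) (A : m.-tuple (set T)) :
  (fun s => ocons (fun v => v = x) (valuation a A) (unlift_inl s)) =
  valuation (cons_tuple x a) A.
Proof.
apply/funext => -[i|//] /=.
by case: unliftP => [j|] -> /=; rewrite ?tnthS ?tnth0.
Qed.

Lemma valuation_inr n m T (X : set T) (a : n.-tuple T) (A : m.-tuple (set T)) :
  (fun s => ocons X (valuation a A) (unlift_inr s)) =
  valuation a (cons_tuple X A).
Proof.
apply/funext => -[//|j] /=.
by case: unliftP => [k|] -> /=; rewrite ?tnthS ?tnth0.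
Qed.

Lemma formula_recognizable n m (f : formula (tree_sig L) n m) :
  exists P, @recognizable L ('I_n + 'I_m) P /\
  forall T (t : str T) a A, tree t -> (forall i, univ t (tnth a i)) ->
  (P T t (valuation a A) <-> sat t f a A).
Proof.
elim: f => {n m}.
- move=> n m [l|] x.
    exists (fun T t A => exists u, univ t u /\
      (label t l u /\ A (inl (tnth x ord0)) u)); split.
      by apply: rec_node; apply: letter_and;
        [apply: letter_label|apply: letter_mem].
    move=> T t a A tt Ha /=; set b := map_tuple _ _.
    have -> : b = [tuple tnth a (tnth x ord0)].
      by apply: eq_from_tnth => i; rewrite tnth_map ord1 (tnth_nth (tnth a
        (tnth x ord0))).
    split; first by move=> [u [_ [H /= <-]]].
    by move=> H; exists (tnth a (tnth x ord0)); do !split.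
  exists (fun T t A => exists v w, [/\ ancestor t v w,
    A (inl (tnth x ord0)) v & A (inl (tnth x ord_max)) w]); split.
    by apply: rec_pair; apply: letter_mem.
  move=> T t a A tt Ha /=; set b := map_tuple _ _.
  have -> : b = [tuple tnth a (tnth x ord0); tnth a (tnth x ord_max)].
    by rewrite /b; case: x {b} => [[|x0 [|x1 []]] Hx] //; apply: val_inj.
  split; first by move=> [u [v [H /= <- <-]]].
  by move=> H; exists (tnth a (tnth x ord0)), (tnth a (tnth x ord_max)).
- move=> n m i j; exists (fun T t A => exists u, univ t u /\
      (A (inl i) u /\ A (inl j) u)); split.
    by apply: rec_node; apply: letter_and; apply: letter_mem.
  move=> T t a A tt Ha /=; split; first by move=> [u [_ [-> ->]]].
  by move=> E; exists (tnth a i).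
- move=> n m i j; exists (fun T t A => exists u, univ t u /\
      (A (inl i) u /\ A (inr j) u)); split.
    by apply: rec_node; apply: letter_and; apply: letter_mem.
  move=> T t a A tt Ha /=; split; first by move=> [u [_ [-> ?]]].
  by move=> E; exists (tnth a i).
- move=> n m f [P [HP Hf]]; exists (fun T t A => ~ P T t A); split;
    first exact: rec_not.
  by move=> T t a A tt Ha /=; have [? ?] := Hf T t a A tt Ha; split; auto.
- move=> n m f [P [HP Hf]] g [Q [HQ Hg]];
    exists (fun T t A => P T t A /\ Q T t A).
  split; first exact: rec_and.
  move=> T t a A tt Ha /=; have [? ?] := Hf T t a A tt Ha.
  by have [? ?] := Hg T t a A tt Ha; split=> -[]; auto.
- move=> n m f [P [HP Hf]].
  (* A node quantifier is a set quantifier restricted to singletons. *)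
  have HR := rec_exset (rec_and (rec_singleton (None : option ('I_n + 'I_m)))
    (rec_reindex (@unlift_inl n m) HP)).
  eexists; split; first exact: HR.
  move=> T t a A tt Ha /=; split.
    move=> [X [UX [/(singletonP UX) [x [Ux ->]]]]].
    rewrite valuation_inl => H; exists x; split=> //; apply/Hf => // i.
    by case: (unliftP ord0 i) => [j|] -> /=; rewrite ?tnthS ?tnth0.
  move=> [x [Ux H]]; exists (fun v => v = x).
  have UX v : v = x -> univ t v by move->.
  split=> //; split; first by apply/(singletonP UX); exists x.
  rewrite valuation_inl; apply/Hf => // i.
  by case: (unliftP ord0 i) => [j|] -> /=; rewrite ?tnthS ?tnth0.
- move=> n m f [P [HP Hf]].
  have HR := rec_exset (rec_reindex (@unlift_inr n m) HP).
  eexists; split; first exact: HR.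
  move=> T t a A tt Ha /=.
  by split=> -[X [UX H]]; exists X; split=> //; move: H; rewrite valuation_inr;
    apply Hf.
Qed.

End Formulas.

(** * Evaluating words along branches *)

Section Dedup.
Variable Q : eqType.

(* Unlike [undup], keeps the first occurrences, so that indices do not grow. *)
Fixpoint dedup (s : seq Q) : seq Q :=
  if s is x :: s' then x :: filter (predC1 x) (dedup s') else [::].

Lemma mem_dedup s : dedup s =i s.
Proof.
elim: s => //= x s IH y; rewrite !inE mem_filter IH /=.
by case: eqP.
Qed.

Lemma dedup_uniq s : uniq (dedup s).
Proof.
elim: s => //= x s IH; rewrite filter_uniq // andbT mem_filter /= eqxx.
by [].
Qed.

Lemma index_dedup x s : index x (dedup s) <= index x s.
Proof.
elim: s => //= y s IH; case: eqP => [//|/eqP ne]; rewrite ltnS.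
apply: leq_trans IH; elim: (dedup s) => //= z r IH.
have [->|nzy] /= := eqVneq z y; first by rewrite (negPf ne); apply: leqW.
by case: eqP.
Qed.

End Dedup.

Section Tracks.
Variables (L Q : finType).
Notation str := (structure (tree_sig L)).
Notation tracks := (#|Q|.-tuple Q).

Lemma update_size (g : Q -> Q) (s : seq Q) :
  size (dedup (map g s ++ enum Q)) == #|Q|.
Proof.
apply/eqP; rewrite cardE; apply/perm_size/uniq_perm.
- exact: dedup_uniq.
- exact: enum_uniq.
- by move=> x; rewrite mem_dedup mem_cat mem_enum orbT.
Qed.

Definition update g s : tracks := Tuple (update_size g s).

Lemma mem_update g s q : q \in update g s.
Proof. by rewrite /= mem_dedup mem_cat mem_enum orbT. Qed.

(** The image of the entry of index [j] occurs at position [j] of the mapped list, perhaps earlier,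
    and [dedup] moves no first occurrence to the right. *)
Lemma index_update g (s : tracks) q0 j : j < #|Q| ->
  index (g (nth q0 s j)) (update g s) <= j.
Proof.
move=> Hj; apply: leq_trans (index_dedup _ _) _.
have Hj' : j < size s by rewrite size_tuple.
rewrite index_cat map_f ?mem_nth // -(nth_map _ (g q0)) //.
apply: (@leq_trans (index (nth (g q0) (map g s) j) (take j.+1 (map g s)))).
  rewrite -{2}(cat_take_drop j.+1 (map g s)) index_cat.
  case: ifP => // /negP; case.
  by rewrite (take_nth (g q0)) ?size_map // mem_rcons mem_head.
set r := take _ _; have : index (nth (g q0) (map g s) j) r < size r.
  by rewrite index_mem /r (take_nth (g q0)) ?size_map // mem_rcons mem_head.
by rewrite size_takel ?size_map // ltnS.
Qed.

Variable delta : forall T, str T -> T -> {ffun Q -> Q}.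
Hypothesis fo_mso_delta : forall D,
  fo_mso 1 (fun T (t : str T) e E => delta t (e 0) = D).

Section OneTree.
Variables (T : Type) (t : str T).

Inductive run (u : T) (q : Q) : T -> Q -> Prop :=
| RunRefl : run u q u q
| RunStep p c q' of run u q p q' & parent t p c : run u q c (delta t c q').

(* [b] lists all states; the run through the state of index [i] moves to an index
   at most [i], since [update] keeps the first occurrences. *)
Inductive tracking : T -> tracks -> Prop :=
| TrackRoot r of is_root t r : tracking r (update id [::])
| TrackChild p c b of tracking p b & parent t p c :
    tracking c (update (delta t c) b).

Definition rank_step (q0 : Q) (c : T) (i j : nat) : Prop :=
  exists p b, [/\ parent t p c, tracking p b
    & j = index (delta t c (nth q0 b i)) (update (delta t c) b)].

Definition constant_rank q0 u v i : Prop :=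
  forall c, univ t c -> strict_ancestor t u c /\ ancestor t c v -> rank_step q0
    c i i.

(* The run of index [i] at [u] has index [j] at [v]; the first child [c] at which
   the index drops is isolated. *)
Inductive rank_run q0 : nat -> T -> T -> nat -> Prop :=
| RankStay i u v of ancestor t u v & constant_rank q0 u v i :
    rank_run q0 i u v i
| RankDrop i i' j u p c v of ancestor t u p & constant_rank q0 u p i &
    parent t p c & rank_step q0 c i i' & i' < i & rank_run q0 i' c v j :
    rank_run q0 i u v j.

Hypothesis tt : tree t.

Lemma run_trans u q v q' w q'' : run u q v q' -> run v q' w q'' -> run u q w q''.
Proof. by move=> H; elim=> // p c s _ IH pc; apply: RunStep pc. Qed.

Lemma run_total u v q : ancestor t u v -> exists q', run u q v q'.
Proof.
move=> uv; apply: (path_ind tt (Q := fun v => exists q', run u q v q') uv).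
  by exists q; apply: RunRefl.
move=> p c _ pc _ [q' H]; exists (delta t c q').
exact: RunStep H pc.
Qed.

Lemma mem_tracking v b q : tracking v b -> q \in b.
Proof. by case=> *; apply: mem_update. Qed.

Lemma tracking_uniq v b b' : tracking v b -> tracking v b' -> b = b'.
Proof.
move=> H; elim: H b' => {v b} [r rr|p c b _ IH pc] b' H.
  case: H rr => // p c b'' _ pc rc; by case: (child_root tt pc).
case: H IH pc => [r rr _ pc|p' c' b'' H' pc' IH pc].
  by case: (child_root tt pc).
by rewrite (IH b'') // (parent_uniq tt pc pc').
Qed.

Lemma tracking_total v : univ t v -> exists b, tracking v b.
Proof.
move=> Uv; have [r Ur Hr] := tree_root tt.
apply: (path_ind tt (Q := fun v => exists b, tracking v b) (Hr v Uv)).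
  by exists (update id [::]); apply: TrackRoot.
by move=> p c _ pc _ [b Hb]; exists (update (delta t c) b); apply: TrackChild pc.
Qed.

(** [rank_run] unfolds from its upper end; here it grows at the lower end. An equal index prolongs
    the last constant stretch, a smaller one opens a new stretch. *)
Lemma rank_run_step q0 i u p j c j' : rank_run q0 i u p j -> parent t p c ->
  rank_step q0 c j j' -> j' <= j -> rank_run q0 i u c j'.
Proof.
move=> H; elim: H => {i u p j} [i u p up Hst|i i' j u p' c' p up' Hst p'c' Hc'
  lt _ IH] pc Hc le;
  last by apply: (RankDrop up' Hst p'c' Hc' lt); apply: IH.
move: le; rewrite leq_eqVlt => /predU1P[E|lt].
  rewrite {j'}E in Hc *; apply: RankStay;
    first exact: (tree_trans tt up (parent_anc pc)).
  move=> c' Uc' [uc' c'c]; have [-> //|ne] := pselect (c' = c).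
  by apply: Hst => //; split=> //; apply: pc.2.
apply: (RankDrop up Hst pc Hc lt); apply: RankStay.
  by apply: (tree_refl tt); apply: anc_univr (parent_anc pc).
by move=> c' _ [[cc' ne] c'c]; case: ne; apply: (tree_antisym tt).
Qed.

Lemma constant_rank_run q0 u v i b : ancestor t u v -> constant_rank q0 u v i ->
  tracking u b -> exists b', tracking v b' /\ run u (nth q0 b i) v (nth q0 b' i).
Proof.
move=> uv Hst Hb.
apply: (path_ind tt (Q := fun v => exists b', tracking v b' /\
   run u (nth q0 b i) v (nth q0 b' i)) uv); first by exists b; split=> //;
     apply: RunRefl.
move=> p c up pc cv [b' [Hb' Hrun]].
have uc : strict_ancestor t u c.
  split=> [|E]; first exact: (tree_trans tt up (parent_anc pc)).
  rewrite -E in pc; have [[pu ne] _] := pc; apply: ne; exact: (tree_antisym tt).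
have [p' [b'' [pc' Hb'' Ei]]] := Hst c (anc_univl cv) (conj uc cv).
rewrite (parent_uniq tt pc' pc) in Hb''; rewrite (tracking_uniq Hb'' Hb') in Ei.
exists (update (delta t c) b'); split; first exact: (TrackChild Hb' pc).
by rewrite {2}Ei nth_index ?mem_update //; apply: RunStep Hrun pc.
Qed.

Lemma rank_run_run q0 i u v j : rank_run q0 i u v j -> forall b, tracking u b ->
  exists b', tracking v b' /\ run u (nth q0 b i) v (nth q0 b' j).
Proof.
elim=> {i u v j} [i u v uv Hst|i i' j u p c v up Hst pc Hc _ _ IH] b Hb.
  exact: constant_rank_run.
have [b1 [Hb1 Hrun]] := constant_rank_run up Hst Hb.
have [p' [b'' [pc' Hb'' Ei]]] := Hc.
rewrite (parent_uniq tt pc' pc) in Hb''; rewrite (tracking_uniq Hb'' Hb1) in Ei.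
have [b2 [Hb2 Hrun2]] := IH _ (TrackChild Hb1 pc).
exists b2; split=> //; apply: run_trans (RunStep Hrun pc) _.
by move: Hrun2; rewrite Ei nth_index ?mem_update.
Qed.

(** From right to left, the stretches are followed one after the other. Conversely, a run starts at
    the index of [q] in the list at [u], and by [index_update] no step raises its index. *)
Lemma runP u q v q' : univ t u -> run u q v q' <->
  exists b b' (j : 'I_#|Q|), [/\ tracking u b, tracking v b',
    rank_run q (index q b) u v j & nth q b' j = q'].
Proof.
move=> Uu; split; last first.
  move=> [b [b' [j [Hb Hb' Hr <-]]]]; have [b2 [Hb2]] := rank_run_run Hr Hb.
  by rewrite (tracking_uniq Hb2 Hb') nth_index // (mem_tracking q Hb).
elim=> {v q'} [|p c s _ [b [b' [j [Hb Hb' Hr <-]]]] pc].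
  have [b Hb] := tracking_total Uu.
  have Hj : index q b < #|Q|.
    by rewrite -[X in _ < X](size_tuple b) index_mem (mem_tracking q Hb).
  exists b, b, (Ordinal Hj); split=> //; last by rewrite nth_index
    ?(mem_tracking q Hb).
  apply: RankStay; first exact: tree_refl.
  by move=> c _ [[uc ne] cu]; case: ne; apply: (tree_antisym tt).
have le := index_update (delta t c) b' q (ltn_ord j).
have Hj := leq_ltn_trans le (ltn_ord j).
exists b, (update (delta t c) b'), (Ordinal Hj); split=> //.
- exact: (TrackChild Hb' pc).
- by apply: (rank_run_step Hr pc _ le); exists p, b'.
- by rewrite [LHS]nth_index // mem_update.
Qed.

End OneTree.

(** A witness against [tracking t v b]: a family closed under both rules of [tracking] that leaves
    out [v] at [b]. *)
Definition avoiding T (t : str T) b (v : T) (F : tracks -> set T) : Prop :=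
  ((forall r, univ t r -> is_root t r -> F (update id [::]) r) /\
   (forall c, univ t c -> forall p, univ t p -> parent t p c ->
      forall D b', delta t c = D -> F b' p -> F (update D b') c)) /\
  ~ F b v.

(** [tracking] is the least closed family. There are finitely many lists, so a family is a finite
    block of sets indexed through [enum_rank], and monadic logic can quantify over it. *)
Lemma tracking_lfp T (t : str T) v b : tree t -> univ t v -> tracking t v b <->
  ~ exists F : nat -> set T, (forall j w, F j w -> univ t w) /\
      avoiding t b v (fun b' => F (enum_rank b')).
Proof.
move=> tt Uv; split.
  move=> H [F [_ [[F0 FS] nF]]]; apply: nF; move: Uv.
  elim: H => {v b} [r rr Ur|p c b _ IH pc Uc]; first exact: F0.
  have Up := anc_univl (parent_anc pc).
  by apply: (FS c Uc p Up pc _ _ erefl); apply: IH.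
move=> H; apply: contrapT => nT; apply: H.
(* The relation [tracking] itself is a closed family. *)
exists (fun (j : nat) w => univ t w /\
  exists2 b' : tracks, j = enum_rank b' :> nat & tracking t w b').
split; first by move=> j w [].
split; first split.
- by move=> r Ur rr; split=> //; exists (update id [::]) => //; apply: TrackRoot.
- move=> c Uc p Up pc D b' <- [_ [b2 /ord_inj/enum_rank_inj <- Hb]]; split=> //.
  by exists (update (delta t c) b') => //; apply: (TrackChild Hb pc).
- by move=> [_ [b2 /ord_inj/enum_rank_inj <-]].
Qed.

Lemma mso_tracking b : mso_unary (fun T (t : str T) v => tracking t v b).
Proof.
move=> m n i Hi; have B := mso_boolean L; set K := #|{: tracks}|.
have Hm n' j (b' : tracks) : j < n' ->
    mso (K + m) n' (fun T (t : str T) e E => E (enum_rank b') (e j)).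
  by move=> Hj; apply: mso_mem => //; apply: ltn_addr.
have HP : mso (K + m) n (fun T (t : str T) e E =>
    avoiding t b (e i) (fun b' => E (enum_rank b'))).
  apply: (cls_and (B _)); last by apply/(cls_not (B _))/Hm.
  apply: (cls_and (B _)).
    apply: (cls_all (B _) (P := fun T t e E => is_root t (e 0) -> E _ (e 0))).
    by apply: (cls_imp (B _)); [apply/fo_mso_mso/fo_mso_root | apply: Hm].
  apply: (cls_all (B _) (P := fun T t e E => forall p, univ t p ->
    parent t p (e 0) -> forall (D : {ffun Q -> Q}) (b' : tracks), delta t (e 0)
      = D ->
    E (enum_rank b') p -> E (enum_rank (update D b')) (e 0))).
  apply: (cls_all (B _) (P := fun T t e E =>
    parent t (e 0) (e 1) -> forall (D : {ffun Q -> Q}) (b' : tracks), delta t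
      (e 1) = D ->
    E (enum_rank b') (e 0) -> E (enum_rank (update D b')) (e 1))).
  apply: (cls_imp (B _)); first exact/fo_mso_mso/fo_mso_parent.
  apply: (cls_fall (B _)) => D; apply: (cls_fall (B _)) => b'.
  apply: (cls_imp (B _)); first exact: (fo_mso_unary (U := fun T t u => delta t
    u = D)).
  by apply: (cls_imp (B _)); apply: Hm.
apply: (cls_ext (B _)) (cls_not (B _) (mso_exsets HP)) => T t e E tt Ht.
have eF (F : nat -> set T) : (fun b' : tracks =>
    if enum_rank b' < K then F (enum_rank b') else E (enum_rank b' - K)) =
   (fun b' => F (enum_rank b')) by apply/funext => b'; rewrite ltn_ord.
apply: iff_trans (iff_sym (tracking_lfp b tt (Ht i Hi))).
by split=> H [F HF]; apply: H; exists F; move: HF; rewrite eF.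
Qed.

Lemma fo_mso_tracking b n i : i < n ->
  fo_mso n (fun T (t : str T) e E => tracking t (e i) b).
Proof.
by move=> Hi; apply: (FoMark (U := fun T t v => tracking t v b)) => //;
  apply: mso_tracking.
Qed.

Lemma fo_mso_delta_at D n i : i < n ->
  fo_mso n (fun T (t : str T) e E => delta t (e i) = D).
Proof. by move=> Hi; apply: (fo_mso_reindex (fo_mso_delta D) (g := fun _ =>
  i)). Qed.

Notation B := (@fo_mso_boolean L).

Lemma fo_mso_rank_step q0 k k' n i : i < n ->
  fo_mso n (fun T (t : str T) e E => rank_step t q0 (e i) k k').
Proof.
move=> Hi.
have H := FoEx (cls_fex B (fun b : tracks => cls_fex B (fun D : {ffun Q -> Q} =>
  cls_and B (fo_mso_parent L (ltn0Sn n) (Hi : i.+1 < n.+1))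
  (cls_and B (fo_mso_tracking b (ltn0Sn n))
  (cls_and B (fo_mso_delta_at D (Hi : i.+1 < n.+1))
   (cls_const B n.+1 (k' = index (D (nth q0 b k)) (update D b)))))))).
apply: FoExt H => T t e E tt Ht /=; split.
  by move=> [p [Up [b [D [pc [Hb [<- ->]]]]]]]; exists p, b.
move=> [p [b [pc Hb Ek]]]; exists p; split;
  first exact: anc_univl (parent_anc pc).
by exists b, (delta t (e i)).
Qed.

Lemma fo_mso_constant_rank q0 k n i j : i < n -> j < n ->
  fo_mso n (fun T (t : str T) e E => constant_rank t q0 (e i) (e j) k).
Proof.
move=> Hi Hj; apply: (cls_all B (P := fun T t e E =>
  strict_ancestor t (e i.+1) (e 0) /\ ancestor t (e 0) (e j.+1) -> rank_step t
    q0 (e 0) k k)).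
apply: (cls_imp B); last exact: fo_mso_rank_step.
by apply: FoAnd; [apply: fo_mso_sanc | apply: FoAnc].
Qed.

(** Induction on the starting index: every drop lowers it, so the unfolding stops after at most [k]
    drops. *)
Lemma fo_mso_rank_run q0 l k : forall n i j, i < n -> j < n ->
  fo_mso n (fun T (t : str T) e E => rank_run t q0 k (e i) (e j) l).
Proof.
elim/ltn_ind: k => k IH n i j Hi Hj.
have H1 := cls_and B (cls_and B (FoAnc L Hi Hj) (fo_mso_constant_rank q0 k Hi Hj))
  (cls_const B n (l = k)).
have Hi' : i.+2 < n.+2 by []. have Hj' : j.+2 < n.+2 by [].
have H01 : 0 < n.+2 by []. have H11 : 1 < n.+2 by [].
have H2 := FoEx (FoEx (cls_fex B (fun k' : 'I_k =>
  cls_and B (cls_and B (FoAnc L Hi' H11) (fo_mso_constant_rank q0 k Hi' H11))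
  (cls_and B (fo_mso_parent L H11 H01)
  (cls_and B (fo_mso_rank_step q0 k k' H01) (IH k' (ltn_ord k') _ _ _ H01
    Hj')))))).
apply: FoExt (cls_or B H1 H2) => T t e E tt Ht /=; split.
  case=> [[[? ?] ->]|[p [_ [c [_ [k' [[? ?] [? [? ?]]]]]]]]];
    first exact: RankStay.
  exact: (@RankDrop _ t q0 k k' l (e i) p c (e j)).
move=> H; inversion H as [k0 u v uv Hst E0 E1 E2 E3|k0 k' l0 u p c v up Hst pc
  Hc lt Hr E0 E1 E2 E3].
  by left.
right; exists p; split; first exact: anc_univr up.
exists c; split; first exact: anc_univr (parent_anc pc).
by exists (Ordinal lt).
Qed.

Lemma fo_mso_run q q' n i j : i < n -> j < n ->
  fo_mso n (fun T (t : str T) e E => run t (e i) q (e j) q').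
Proof.
move=> Hi Hj.
have H := cls_fex B (fun b : tracks => cls_fex B (fun b' : tracks =>
  cls_fex B (fun l : 'I_#|Q| => cls_and B
   (cls_and B (fo_mso_tracking b Hi) (fo_mso_tracking b' Hj))
   (cls_and B (fo_mso_rank_run q l (index q b) Hi Hj) (cls_const B n (nth q b'
     l = q')))))).
apply: FoExt H => T t e E tt Ht; rewrite (runP tt _ _ _ (Ht i Hi)) /=.
split=> -[b [b' [l]]]; first by move=> [[? ?] [? ?]]; exists b, b', l.
by move=> [? ? ? ?]; exists b, b', l.
Qed.

End Tracks.

(** * One-step functions *)

Lemma real_mono T K (w : seq K) : forall R R' : K -> T -> Prop,
  (forall k x, R k x -> R' k x) -> real R w -> real R' w.
Proof.
elim: w => //= k w IH R R' H [x [Rx Hw]]; exists x; split; first exact: H.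
by apply: IH Hw => k' y [? ?]; split=> //; apply: H.
Qed.

(** One new element [c] of colour [theta] is added: either the word is realised without it, or [c]
    takes one of its positions and the rest is realised as before. *)
Lemma real_add T K (c : T) (theta : K) (w : seq K) : forall R0 R : K -> T -> Prop,
  (forall k x, R k x <-> R0 k x \/ x = c /\ k = theta) -> (forall k, ~ R0 k c) ->
  real R w <-> real R0 w \/
    exists w1 w2, w = w1 ++ theta :: w2 /\ real R0 (w1 ++ w2).
Proof.
elim: w => [|k w IH] R0 R HR nc; first by split=> // _; left.
have step x : x <> c -> real (fun k' y => R k' y /\ y <> x) w <->
    real (fun k' y => R0 k' y /\ y <> x) w \/ exists w1 w2,
      w = w1 ++ theta :: w2 /\ real (fun k' y => R0 k' y /\ y <> x) (w1 ++ w2).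
  move=> nxc; apply: IH => [k' y|k' []]; last by move/nc.
  rewrite HR; split=> [[[?|[-> ->]] ?]|[[? ?]|[-> ->]]].
  - by left.
  - by right.
  - by split=> //; left.
  - by split; [right|move=> E; apply: nxc].
have stepc : real (fun k' y => R k' y /\ y <> c) w <-> real R0 w.
  apply: eq_real => k' y; rewrite HR; split=> [[[//|[]] ? //]|H].
  by split; [left | move=> E; apply: (nc k'); rewrite -E].
split.
  move=> /= [x [/HR [R0x|[-> ->]] Hw]]; last first.
    by right; exists [::], w; split=> //; apply/stepc.
  have nxc : x <> c by move=> E; apply: (nc k); rewrite -E.
  case/(step x nxc): Hw => [Hw|[w1 [w2 [-> Hw]]]].
    by left; exists x.
  by right; exists (k :: w1), w2; split=> //; exists x.
case; first by apply: real_mono => k' y ?; apply/HR; left.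
move=> [[|k1 w1] [w2 [[E1 E2] /= Hw]]].
  by exists c; split; [apply/HR; right | apply/stepc; rewrite E2].
case: Hw => x [R0x Hw]; rewrite -E1 in R0x.
have nxc : x <> c by move=> E; apply: (nc k); rewrite -E.
exists x; split; first by apply/HR; left.
by apply/(step x nxc); right; exists w1, w2.
Qed.

Section FoReal.
Variable L : finType.
Notation B := (@fo_mso_boolean L).

Lemma fo_mso_real K (w : seq K) : forall n (R : K -> query L),
  (forall k, fo_mso n.+1 (R k)) ->
  fo_mso n (fun T t e E => real (fun k z => univ t z /\ R k T t (scons z e) E) w).
Proof.
elim: w => [|k w IH] n R HR /=; first exact: (cls_true B).
(* Under the inner binder, index 0 is the current element and 1 the one picked just before; [g]
   skips the latter. *)
pose g i := if i is j.+1 then j.+2 else 0.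
have HR' k' : fo_mso n.+2 (fun T t e E => R k' T t (fun i => e (g i)) E /\ ~ e
  0 = e 1).
  apply: (cls_and B); last exact/FoNot/FoEq.
  by apply: (fo_mso_reindex (HR k')) => -[].
apply: FoExt (FoEx (cls_and B (HR k) (IH _ _ HR'))) => T t e E tt Ht.
have eg x y : (fun i => scons y (scons x e) (g i)) = scons y e.
  by apply/funext => -[].
split=> [[x [Ux [Rx Hw]]]|[x [[Ux Rx] Hw]]]; exists x; split=> //; try split=> //;
  move: Hw; apply: real_mono => k' y /=; rewrite eg; first by case=> ? [].
by case=> -[].
Qed.

End FoReal.

Lemma ffun_asbool (X : finType) (Q : X -> Prop) (f : {ffun X -> bool}) :
  [ffun x => `[< Q x >]] = f <-> forall x, Q x <-> f x.
Proof.
split=> [<- x|H]; first by rewrite ffunE; split=> /asboolP.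
apply/ffunP => x; rewrite ffunE; apply/idP/idP => [/asboolP/H //|?].
exact/asboolP/H.
Qed.

Section Contexts.
Variables (L V : finType) (I : @compositional L V).
Notation str := (structure (tree_sig L)).
Notation Theta := (itype I).
Notation N := (ibound I).
Notation B := (@fo_mso_boolean L).

Definition labels T (t : str T) u : {ffun L -> bool} :=
  [ffun l => `[< label t l u >]].
Definition members T (A : V -> set T) u : {ffun V -> bool} :=
  [ffun i => `[< A i u >]].
Definition words T (R : Theta -> T -> Prop) : {ffun N.-bseq Theta -> bool} :=
  [ffun w => `[< real R (w : N.-bseq Theta) >]].

Lemma words_sim T T' C (chi : T -> Theta) C' (chi' : T' -> Theta) :
  words (color C chi) = words (color C' chi') -> sim N C chi C' chi'.
Proof.
move=> /ffun_asbool H w Hw; apply: iff_trans (H (Bseq Hw)) _.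
by rewrite ffunE; split=> /asboolP.
Qed.

(** By [icomp] the value is determined by data from a finite type, uniformly in all trees; [theta0]
    serves for data that never occur. *)
Lemma local_function (theta0 : Theta) :
  exists G : {ffun L -> bool} -> {ffun V -> bool} ->
             {ffun N.-bseq Theta -> bool} -> Theta,
  forall T (t : str T) A u, tree t -> univ t u ->
  ifun I t A u = G (labels t u) (members A u) (words (color (parent t u) (ifun
    I t A))).
Proof.
pose data T t (A : V -> set T) u :=
  (labels t u, members A u, words (color (parent t u) (ifun I t A))).
have [G HG] : exists G, forall y, forall T (t : str T) A u, tree t -> univ t u ->
    data T t A u = y -> ifun I t A u = G y.
  suff /choice [G HG] y : exists theta, forall T (t : str T) A u, tree t ->
      univ t u -> data T t A u = y -> ifun I t A u = theta by exists G.
  have [[T [t [A [u [tt [Uu <-]]]]]]|H] := pselect (exists T (t : str T) A u,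
      tree t /\ (univ t u /\ data T t A u = y)); last first.
    by exists theta0 => T t A u tt Uu E; case: H; exists T, t, A, u.
  exists (ifun I t A u) => T' t' A' u' tt' Uu' [E1 E2 E3].
  apply: icomp => //; last exact: words_sim.
  split=> i; first by move/ffun_asbool: E1 => /(_ i) ->; rewrite ffunE;
    split=> /asboolP.
  by move/ffun_asbool: E2 => /(_ i) ->; rewrite ffunE; split=> /asboolP.
by exists (fun a b c => G (a, b, c)) => T t A u tt Uu; apply: HG.
Qed.

Variable G : {ffun L -> bool} -> {ffun V -> bool} ->
             {ffun N.-bseq Theta -> bool} -> Theta.
Hypothesis HG : forall T (t : str T) A u, tree t -> univ t u ->
  ifun I t A u = G (labels t u) (members A u) (words (color (parent t u) (ifun
    I t A))).

Definition no_set T (i : V) : set T := fun _ => False.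

(** One quantified set, forced to be empty, instantiates all parameters. *)
Lemma mso_empty c : mso_unary (fun T (t : str T) u => ifun I t (@no_set T) u = c).
Proof.
move=> m n i Hi; have Bm := mso_boolean L m.+1.
have H := mso_exset (cls_and Bm (cls_not Bm (cls_ex Bm
  (mso_mem L (ltn0Sn n) (ltn0Sn m))))
  (@idef _ _ I c m.+1 n i (fun _ => 0) Hi (fun _ => ltn0Sn m))).
apply: (cls_ext (mso_boolean L m)) H => T t e E tt Ht /=.
have E0 X : ~ (exists u : T, univ t u /\ X u) -> (forall v, X v -> univ t v) ->
    (fun _ : V => X) = @no_set T.
  move=> H UX; apply/funext => v; apply/funext => u; apply/propext; split=> // Xu.
  by apply: H; exists u; split=> //; apply: UX.
split; first by move=> [X [UX [H <-]]]; rewrite -(E0 X).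
move=> H; exists (fun _ => False); split=> //; split; first by case=> u [].
by rewrite -H.
Qed.

Lemma fo_mso_empty c n i : i < n ->
  fo_mso n (fun T (t : str T) e E => ifun I t (@no_set T) (e i) = c).
Proof.
move=> Hi; apply: (FoMark (U := fun T t u => ifun I t (@no_set T) u = c)) => //.
exact: mso_empty.
Qed.

Definition sibling T (t : str T) c y : Prop :=
  exists p, univ t p /\ (parent t p c /\ (parent t p y /\ ~ y = c)).
Definition sibling_words T (t : str T) c :=
  words (color (sibling t c) (ifun I t (@no_set T))).
(** The labels of the parent are read off at the child, so that the whole step function becomes a
    letter attached to [c]. *)
Definition parent_labels T (t : str T) c : {ffun L -> bool} :=
  [ffun l => `[< exists p, univ t p /\ (parent t p c /\ label t l p) >]].

(* The words realised after adding one element of colour [theta]. *)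
Definition add_word (kappa : {ffun N.-bseq Theta -> bool}) (theta : Theta)
    : {ffun N.-bseq Theta -> bool} :=
  [ffun w : N.-bseq Theta => `[< kappa w \/ exists w1 w2 (w' : N.-bseq Theta),
     [/\ w = w1 ++ theta :: w2 :> seq Theta, w' = w1 ++ w2 :> seq Theta & kappa
       w'] >]].

(* The value at a node with no point, as a function of the value at the one child
   whose subtree contains points. *)
Definition context lam kappa : {ffun Theta -> Theta} :=
  [ffun theta => G lam [ffun=> false] (add_word kappa theta)].
Definition step_fun T (t : str T) c : {ffun Theta -> Theta} :=
  context (parent_labels t c) (sibling_words t c).

(** All points lie below [c]: [p] carries none, and the siblings of [c] keep their marked values.
    Only the value at [c] is variable. *)
Lemma step_funE T (t : str T) A p c : tree t -> parent t p c ->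
  (forall i v, A i v -> ancestor t c v) ->
  ifun I t A p = step_fun t c (ifun I t A c).
Proof.
move=> tt pc HA; have [[pa ne] Hp] := pc; have Up := anc_univl pa.
rewrite (HG A tt Up) ffunE; congr G.
- apply/ffun_asbool => l; rewrite ffunE; split=> [H|/asboolP [p' [_ [p'c]]]].
    by apply/asboolP; exists p.
  by rewrite (parent_uniq tt p'c pc).
- apply/ffun_asbool => i; rewrite ffunE; split=> // /HA cp.
  by case: ne; apply: (tree_antisym tt).
- have sibE y : parent t p y -> y <> c -> ifun I t A y = ifun I t (@no_set T) y.
    move=> py nyc; apply: ilocal => // v yv i; split=> // /HA cv.
    by case: nyc; exact: (children_disjoint tt py pc yv cv).
  have Hadd w := @real_add _ _ c (ifun I t A c) w (color (sibling t c) (ifun I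
    t (@no_set T)))
    (color (parent t p) (ifun I t A)).
  apply/ffun_asbool => w; rewrite ffunE; apply: (iff_trans (Hadd _ _ _)).
  + move=> k y; split.
      move=> [py <-]; have [->|nyc] := pselect (y = c); [by right | left].
      by split; [exists p | rewrite sibE].
    move=> [[[p' [_ [p'c [p'y nyc]]]] <-]|[-> ->]]; last by [].
    by rewrite (parent_uniq tt p'c pc) in p'y; split=> //; apply: sibE.
  + by move=> k [[p' [_ [_ [_ []]]]]].
  + split.
      move=> H; apply/asboolP; case: H => [H|[w1 [w2 [Ew H]]]].
        by left; rewrite ffunE; apply/asboolP.
      have Hs : size (w1 ++ w2) <= N.
        apply: leq_trans (size_bseq w); rewrite Ew !size_cat /= addnS;
          exact: leqnSn.
      right; exists w1, w2, (Bseq Hs); split=> //.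
      by rewrite ffunE; apply/asboolP.
    move=> /asboolP [|[w1 [w2 [w' [E E']]]]]; rewrite ffunE => /asboolP H;
      first by left.
    by right; exists w1, w2; split=> //; rewrite -E'.
Qed.

Lemma fo_mso_step_fun F : fo_mso 1 (fun T (t : str T) e E => step_fun t (e 0) =
  F).
Proof.
have G1 : fo_mso 1 (fun T (t : str T) e E => exists lam kappa,
    (context lam kappa = F) /\
    ((forall l, (exists p, univ t p /\ (parent t p (e 0) /\ label t l p)) <->
      lam l) /\
     (forall w : N.-bseq Theta, real (fun k z => univ t z /\
        (sibling t (e 0) z /\ ifun I t (@no_set T) z = k)) w <-> kappa w))).
  apply: (cls_fex B) => lam; apply: (cls_fex B) => kappa.
  apply: (cls_and B); first exact: (cls_const B).
  apply: (cls_and B); apply: (cls_fall B) => x; apply: (cls_iff B);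
    try exact: (cls_const B).
    apply: (cls_ex B (P := fun T t e E => parent t (e 0) (e 1) /\ label t x (e
      0))).
    by apply: (cls_and B); [apply: fo_mso_parent | apply: (cls_lab B)].
  apply: (@fo_mso_real L _ _ _ (fun k T t e E => sibling t (e 1) (e 0) /\
     ifun I t (@no_set T) (e 0) = k)) => k.
  apply: (cls_and B); last exact: fo_mso_empty.
  apply: (cls_ex B (P := fun T t e E => parent t (e 0) (e 2) /\
    (parent t (e 0) (e 1) /\ ~ e 1 = e 2))).
  apply: (cls_and B); first exact: fo_mso_parent.
  by apply: (cls_and B); [apply: fo_mso_parent | apply/FoNot/FoEq].
apply: FoExt G1 => T t e E tt Ht.
have sibE w : real (fun k z => univ t z /\ (sibling t (e 0) z /\
    ifun I t (@no_set T) z = k)) w <->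
    real (color (sibling t (e 0)) (ifun I t (@no_set T))) w.
  apply: eq_real => k z; split; first by case.
  move=> H; split=> //; case: H => -[p [_ [_ [pz _]]]] _.
  exact: anc_univr (parent_anc pz).
split.
  move=> [lam [kappa [<- [H1 H2]]]]; rewrite /step_fun; congr context.
    exact/ffun_asbool.
  by apply/ffun_asbool => w; apply: iff_trans (H2 w); apply: iff_sym.
move=> H; exists (parent_labels t (e 0)), (sibling_words t (e 0)); split=> //.
split; first exact: (proj1 (ffun_asbool _ _) erefl).
by move=> w; apply: (iff_trans (sibE w)); apply: (proj1 (ffun_asbool _ _) erefl).
Qed.

(** Runs go down while values travel up. A state is therefore a function from the value at the
    current node to the value at the starting node, and each step composes on the right. *)
Definition precompose T (t : str T) c
    : {ffun {ffun Theta -> Theta} -> {ffun Theta -> Theta}} :=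
  [ffun F : {ffun Theta -> Theta} => [ffun theta => F (step_fun t c theta)]].

Lemma fo_mso_precompose D : fo_mso 1 (fun T (t : str T) e E => precompose t (e
  0) = D).
Proof.
have H := cls_fex B (fun F => cls_and B (fo_mso_step_fun F)
  (cls_const B 1 ([ffun F' : {ffun Theta -> Theta} => [ffun theta => F' (F
    theta)]] = D))).
apply: FoExt H => T t e E tt Ht.
by split=> [[F [<-]] //|H]; exists (step_fun t (e 0)).
Qed.

Lemma run_precompose T (t : str T) A u v F F' : tree t ->
  run precompose t u F v F' -> (forall i w, A i w -> ancestor t v w) ->
  F' (ifun I t A v) = F (ifun I t A u).
Proof.
move=> tt; elim=> // p c F1 _ IH pc HA.
rewrite 2!ffunE -(step_funE tt pc HA); apply: IH => i w /HA.
exact: (tree_trans tt (parent_anc pc)).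
Qed.

End Contexts.

(** * Formulae with free nodes *)

Section Points.
Variables (L : finType) (n : nat) (I : @compositional L 'I_n).
Notation str := (structure (tree_sig L)).
Notation Theta := (itype I).
Notation N := (ibound I).
Notation B := (@fo_mso_boolean L).

Variable G : {ffun L -> bool} -> {ffun 'I_n -> bool} ->
             {ffun N.-bseq Theta -> bool} -> Theta.
Hypothesis HG : forall T (t : str T) A u, tree t -> univ t u ->
  ifun I t A u =
  G (labels t u) (members A u) (words (color (parent t u) (ifun I t A))).

Definition points (J : {set 'I_n}) T (x : nat -> T) (i : 'I_n) : set T :=
  fun v => i \in J /\ v = x i.

Section Semantics.
Variables (J : {set 'I_n}) (T : Type) (t : str T) (x : nat -> T).

(* The type of a node below which only the points of some [K \proper J] lie. *)
Definition lower (y : T) (c : Theta) : Prop :=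
  exists K : {set 'I_n}, K \proper J /\
    ((forall i : 'I_n, (i \in J /\ ancestor t y (x i)) <-> i \in K) /\
     ifun I t (points K x) y = c).

Definition covers (u : T) : Prop := forall i : 'I_n, i \in J -> ancestor t u (x
  i).

Definition meet (v : T) : Prop :=
  covers v /\ forall c, univ t c -> parent t v c -> ~ covers c.

(** An application of [G] in which the values of the children come from [lower], hence from strictly
    fewer points. *)
Definition at_meet (v : T) (c : Theta) : Prop :=
  exists lam mu kappa, G lam mu kappa = c /\
    (((forall l, label t l v <-> lam l) /\ (forall i, points J x i v <-> mu i)) /\
     forall w : N.-bseq Theta,
       real (fun k y => univ t y /\ (parent t v y /\ lower y k)) w <-> kappa w).

Hypothesis tt : tree t.

Lemma lower_type y c : lower y c -> ifun I t (points J x) y = c.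
Proof.
move=> [K [KJ [HK <-]]]; apply: ilocal => // v yv i.
split=> -[iJ E]; split=> //; last exact: (subsetP (proper_sub KJ)).
by apply/HK; rewrite -E.
Qed.

Lemma type_lower y : ~ covers y -> lower y (ifun I t (points J x) y).
Proof.
move=> nc; pose K : {set 'I_n} := [set i | (i \in J) && `[< ancestor t y (x i)
  >]].
have HK (i : 'I_n) : (i \in J /\ ancestor t y (x i)) <-> i \in K.
  rewrite inE; split=> [[-> ?]|/andP[-> /asboolP]//]; exact/asboolP.
have HL : lower y (ifun I t (points K x) y).
  exists K; split=> //; apply/properP; split.
    by apply/fintype.subsetP => i /HK [].
  apply: contrapT => H; apply: nc => i iJ;
    have [//|H'] := pselect (ancestor t y (x i)).
  by case: H; exists i => //; apply/negP => /HK [].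
by rewrite (lower_type HL).
Qed.

Lemma at_meetP v c : univ t v -> meet v ->
  at_meet v c <-> ifun I t (points J x) v = c.
Proof.
move=> Uv [_ Hv].
have HR w : real (fun k y => univ t y /\ (parent t v y /\ lower y k)) w <->
    real (color (parent t v) (ifun I t (points J x))) w.
  apply: eq_real => k y; split; first by move=> [_ [vy /lower_type <-]].
  move=> [vy <-]; have Uy := anc_univr (parent_anc vy).
  by split=> //; split=> //; apply/type_lower/Hv.
rewrite (HG _ tt Uv); split.
  move=> [lam [mu [kappa [<- [[H1 H2] H3]]]]]; congr G; apply/ffun_asbool => //.
  by move=> w; apply: iff_trans (H3 w); apply: iff_sym.
move=> <-; exists (labels t v), (members (points J x) v),
  (words (color (parent t v) (ifun I t (points J x)))); split=> //.
split; first by split; apply: (proj1 (ffun_asbool _ _) erefl).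
by move=> w; apply: (iff_trans (HR w)); apply: (proj1 (ffun_asbool _ _) erefl).
Qed.

(** Without a meet, covering nodes would continue along the branch down to [x i0] and then to one of
    its children, which cannot be an ancestor of [x i0]. *)
Lemma meet_exists u i0 : i0 \in J -> covers u -> exists v, meet v /\ ancestor t
  u v.
Proof.
move=> i0J Hu; apply: contrapT => nm.
have next v : ancestor t u v -> covers v -> exists c, parent t v c /\ covers c.
  move=> uv Hv; apply: contrapT => H; apply: nm; exists v; split=> //;
    split=> // c _ vc Hc.
  by apply: H; exists c.
have ux := Hu _ i0J.
have : covers (x i0).
  apply: (path_ind tt (Q := covers) ux) => // p c up pc cx /(next p up) [c'
    [pc' Hc']].
  by rewrite (children_disjoint tt pc pc' cx (Hc' _ i0J)).
move=> /(next _ ux) [c [[[xc ne] _] Hc]]; apply: ne.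
exact: (tree_antisym tt xc (Hc _ i0J)).
Qed.

Definition id_ffun : {ffun Theta -> Theta} := [ffun c => c].

Lemma points_typeP u c : univ t u -> J != set0 ->
  ifun I t (points J x) u = c <->
  lower u c \/ exists v, univ t v /\ ((meet v /\ ancestor t u v) /\
    exists F c', (run (precompose G) t u id_ffun v F /\ at_meet v c') /\ F c' =
      c).
Proof.
move=> Uu /set0Pn [i0 i0J]; split; last first.
  case=> [/lower_type //|[v [Uv [[Hv uv] [F [c' [[Hr /(at_meetP _ Uv Hv) <-]
    <-]]]]]]].
  rewrite (run_precompose HG tt Hr) ?ffunE // => i w [iJ ->].
  exact: Hv.1.
move=> <-; have [Hu|nu] := pselect (covers u); last by left; apply: type_lower.
right; have [v [Hv uv]] := meet_exists i0J Hu.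
have Uv := anc_univr uv; have [F Hr] := run_total (precompose G) tt id_ffun uv.
exists v; do !split=> //; try exact: Hv.1; try exact: Hv.2.
exists F, (ifun I t (points J x) v); split.
  by split=> //; apply/at_meetP.
rewrite (run_precompose HG tt Hr) ?ffunE // => i w [iJ ->].
exact: Hv.1.
Qed.

End Semantics.

(** The offset [s] is the index of the first point, which varies with the number of nodes bound in
    front. *)
Lemma fo_mso_lower (J : {set 'I_n}) :
  (forall K : {set 'I_n}, K \proper J -> forall c, fo_mso n.+1 (fun T (t : str
    T) e E =>
      ifun I t (points K (fun i => e i.+1)) (e 0) = c)) ->
  forall k s j c, j < k -> s + n <= k -> fo_mso k (fun T (t : str T) e E =>
    lower J t (fun i => e (s + i)) (e j) c).
Proof.
move=> HK k s j c Hj Hs.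
have Hi (i : 'I_n) : s + i < k by apply: leq_trans Hs; rewrite ltn_add2l.
apply: (cls_fex B) => K; have [KJ|nKJ] := pselect (K \proper J); last first.
  by apply: (cls_ext B) (cls_const B k False) => T t e E _ _; split=> // -[].
apply: (cls_and B); first exact: (cls_const B).
apply: (cls_and B).
  apply: (cls_fall B) => i; apply: (cls_iff B); last exact: (cls_const B).
  by apply: (cls_and B); [exact: (cls_const B) | apply: FoAnc].
apply: (fo_mso_reindex (HK K KJ c) (g := fun i => if i is i'.+1 then s + i'
  else j)).
move=> [|i] //; rewrite ltnS => Hin; exact: (Hi (Ordinal Hin)).
Qed.

Lemma fo_mso_covers (J : {set 'I_n}) k s j : j < k -> s + n <= k ->
  fo_mso k (fun T (t : str T) e E => covers J t (fun i => e (s + i)) (e j)).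
Proof.
move=> Hj Hs; apply: (cls_fall B) => i; apply: (cls_imp B);
  first exact: (cls_const B).
by apply: FoAnc => //; apply: leq_trans Hs; rewrite ltn_add2l.
Qed.

(** Induction on the number of points; with no point left, the value is a mark. *)
Lemma fo_mso_points (J : {set 'I_n}) c :
  fo_mso n.+1 (fun T (t : str T) e E =>
    ifun I t (points J (fun i => e i.+1)) (e 0) = c).
Proof.
have [m] := ubnP #|J|; elim: m J c => // m IH J c Jm.
have [->|J0] := eqVneq J set0.
  apply: (cls_ext B) (fo_mso_empty c (ltn0Sn n)) => T t e E tt Ht.
  suff -> : points set0 (fun i => e i.+1) = @no_set 'I_n T by [].
  apply/funext => i; apply/funext => v; apply/propext.
  by split=> // -[]; rewrite inE.
have low := @fo_mso_lower J (fun K KJ c => IH K c (leq_trans (proper_card KJ)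
  Jm)).
have Hmeet : fo_mso n.+2 (fun T (t : str T) e E => meet J t (fun i => e (2 +
  i)) (e 0)).
  apply: (cls_and B); first exact: fo_mso_covers.
  apply: (cls_all B (P := fun T t e E => parent t (e 1) (e 0) ->
    ~ covers J t (fun i => e (3 + i)) (e 0))).
  by apply: (cls_imp B); [apply: fo_mso_parent | apply/FoNot/fo_mso_covers].
have Hat c' : fo_mso n.+2 (fun T (t : str T) e E => at_meet J t (fun i => e (2
  + i)) (e 0) c').
  apply: (cls_fex B) => lam; apply: (cls_fex B) => mu;
    apply: (cls_fex B) => kappa.
  apply: (cls_and B); first exact: (cls_const B).
  apply: (cls_and B); first apply: (cls_and B); apply: (cls_fall B) => y;
    apply: (cls_iff B); try exact: (cls_const B).
  - exact: (cls_lab B).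
  - apply: (cls_and B); first exact: (cls_const B).
    by apply: FoEq => //; rewrite !ltnS.
  - apply: (@fo_mso_real L _ _ _ (fun k T t e E => parent t (e 1) (e 0) /\
      lower J t (fun i => e (3 + i)) (e 0) k)) => k.
    by apply: (cls_and B); [apply: fo_mso_parent | apply: low].
have H := cls_or B (low n.+1 1 0 c (ltn0Sn n) (leqnn _)) (FoEx (cls_and B
  (cls_and B Hmeet (FoAnc L (isT : 1 < n.+2) (ltn0Sn n.+1)))
  (cls_fex B (fun F => cls_fex B (fun c' => cls_and B (cls_and B
    (fo_mso_run (fo_mso_precompose G) id_ffun F (isT : 1 < n.+2) (ltn0Sn n.+1))
      (Hat c'))
    (cls_const B n.+2 (F c' = c))))))).
apply: FoExt H => T t e E tt Ht; apply: iff_sym.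
exact: (points_typeP _ tt c (Ht 0 isT) J0).
Qed.

End Points.

Lemma fo_mso_formula (L : finType) n (f : formula (tree_sig L) n 0) :
  fo_mso n (fun T (t : structure (tree_sig L) T) e E => sat t f (env n e)
    [tuple]).
Proof.
have B := @fo_mso_boolean L.
have [P [HP Hf]] := formula_recognizable f.
pose h (s : 'I_n + 'I_0) : 'I_n :=
  match s with inl i => i | inr j => False_rect _ (notF (ltn_ord j)) end.
have [I [acc HI]] := rec_reindex h HP.
have Hg c : fo_mso n.+1 (fun T (t : structure (tree_sig L) T) e E =>
    ifun I t (points [set: 'I_n] (fun i => e i.+1)) (e 0) = c).
  (* [c] doubles as the default value of the local function. *)
  by have [G HG] := local_function c; apply: fo_mso_points HG _ _.
have H := FoEx (cls_and B (fo_mso_root L (ltn0Sn n)) (cls_fex B (fun c =>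
  cls_and B (Hg c) (cls_const B n.+1 (acc c))))).
apply: FoExt H => T t e E tt Ht.
have Ha i : univ t (tnth (env n e) i) by rewrite tnth_env; apply: Ht.
have -> : sat t f (env n e) [tuple] = P T t (fun s => points [set: 'I_n] e (h s)).
  apply/propext; apply: iff_trans (iff_sym (Hf _ _ _ _ tt Ha)) _.
  suff -> : valuation (env n e) [tuple] = (fun s => points [set: 'I_n] e (h s))
    by [].
  apply/funext => -[i|[]//]; apply/funext => v; apply/propext.
  by rewrite /= /points inE tnth_env; split=> [|[]].
split=> /=.
  move=> [r [Ur [rr [c [Ec Hc]]]]]; apply/(HI _ _ _ _ tt rr).
  by move: Hc; rewrite -Ec.
move=> H; have [r Ur Hr] := tree_root tt; have rr : is_root t r by split.
exists r; split=> //; split=> //; exists (ifun I t (points [set: 'I_n] e) r).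
by split=> //; apply/(HI _ _ _ _ tt rr).
Qed.

(** * Marking and first-order formulae *)

Lemma structure_ext (sg : signature) T (S S' : structure sg T) :
  univ S = univ S' -> (forall R, Defs.rel S R = Defs.rel S' R) -> S = S'.
Proof.
case: S S' => U r H [U' r' H'] /= EU ER; subst U'.
have Er : r = r' by apply/functional_extensionality_dep.
by subst r'; rewrite (Prop_irrelevance H H').
Qed.

Section Marks.
Variable sg : signature.

Definition marks (L : finType) (mf : L -> formula sg 1 0)
    : interpretation sg (mark_sig sg L) :=
  @Interpretation sg (mark_sig sg L) (Equal ord0 ord0)
    (fun R => match R return formula sg (arity (s := mark_sig sg L) R) 0 with
     | inl R => Atom R (ord_tuple (arity R))
     | inr l => mf l
     end).

Lemma marks_univ (L : finType) (mf : L -> formula sg 1 0) T (S : structure sg T) :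
  univ (interp (marks mf) S) = univ S.
Proof. by apply/funext => u; apply/propext; split=> [[]|]. Qed.

Lemma marks_rel (L : finType) (mf : L -> formula sg 1 0) T (S : structure sg T)
    (R : sym sg) :
  Defs.rel (interp (marks mf) S) (inl R) = Defs.rel S R.
Proof.
apply/funext => a; apply/propext; rewrite /= /interp_rel /=.
have E : map_tuple (tnth a) (ord_tuple (arity R)) = a.
  by apply: eq_from_tnth => i; rewrite tnth_map tnth_ord_tuple.
split; first by move=> [_]; rewrite E.
move=> Ra; split; last by rewrite E.
by move=> j; split=> //; apply: rel_univ Ra j.
Qed.

Lemma marking_marks (L : finType) (mf : L -> formula sg 1 0) : marking (marks mf).
Proof. by move=> T S; split; [apply: marks_univ | apply: marks_rel]. Qed.

(** Moves a formula to a larger set of marks, so that several markings can be merged into one. *)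
Fixpoint rename_marks (L L' : finType) (h : L -> L') n m
    (f : formula (mark_sig sg L) n m) : formula (mark_sig sg L') n m :=
  match f with
  | Atom R x =>
      match R return (arity (s := mark_sig sg L) R).-tuple 'I_n ->
                     formula (mark_sig sg L') n m with
      | inl R => fun x => @Atom (mark_sig sg L') n m (inl R) x
      | inr l => fun x => @Atom (mark_sig sg L') n m (inr (h l)) x
      end x
  | Equal i j => Equal i j
  | Member i j => Member i j
  | Not f => Not (rename_marks h f)
  | And f g => And (rename_marks h f) (rename_marks h g)
  | Exists f => Exists (rename_marks h f)
  | ExistsSet f => ExistsSet (rename_marks h f)
  end.

Lemma rename_marks_fo (L L' : finType) (h : L -> L') n m
    (f : formula (mark_sig sg L) n m) :
  first_order (rename_marks h f) = first_order f.
Proof. by elim: f => //= [? ? [] //|? ? f -> g ->]. Qed.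

Lemma sat_rename_marks (L L' : finType) (h : L -> L') (mf : L' -> formula sg 1 0)
    T (S : structure sg T) n m (f : formula (mark_sig sg L) n m) a A :
  sat (interp (marks mf) S) (rename_marks h f) a A =
  sat (interp (marks (mf \o h)) S) f a A.
Proof.
elim: f a A => //= {n m}.
- by move=> n m [].
- by move=> n m f IH a A; rewrite IH.
- by move=> n m f IHf g IHg a A; rewrite IHf IHg.
- by move=> n m f IH a A; congr (ex _); apply/funext => u; rewrite IH.
- by move=> n m f IH a A; congr (ex _); apply/funext => X; rewrite IH.
Qed.

End Marks.

Section FirstOrder.
Variable L : finType.
Notation str := (structure (tree_sig L)).

Definition fo_marked n (P : query L) (L' : finType) (mf : L' -> formula
  (tree_sig L) 1 0)
    (f : formula (mark_sig (tree_sig L) L') n 0) : Prop :=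
  first_order f /\ forall T (t : str T) e E, tree t ->
    (forall i, i < n -> univ t (e i)) ->
    (P T t e E <-> sat (interp (marks mf) t) f (env n e) [tuple]).

(** Each use of [FoMark] contributes one new label; a conjunction takes the disjoint union of the
    labels of both sides. *)
Lemma fo_mso_fo_marked n (P : query L) : fo_mso n P ->
  exists L' mf f, @fo_marked n P L' mf f.
Proof.
elim=> {n P}.
- move=> n P Q PQ _ [L' [mf [f [fo H]]]]; exists L', mf, f;
    split=> // T t e E tt Ht.
  by apply: iff_trans (H T t e E tt Ht); apply: iff_sym; apply: PQ.
- move=> n i j Hi Hj; exists void, (fun l : void => match l with end).
  exists (Equal (Ordinal Hi) (Ordinal Hj)); split=> // T t e E tt Ht.
  by rewrite /= !tnth_env.
- move=> n i j Hi Hj; exists void, (fun l : void => match l with end).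
  exists (@Atom (mark_sig (tree_sig L) void) n 0 (inl None)
    [tuple Ordinal Hi; Ordinal Hj]); split=> // T t e E tt Ht.
  rewrite [sat _ _]/sat marks_rel /ancestor.
  have -> // : map_tuple (tnth (env n e)) [tuple Ordinal Hi; Ordinal Hj] =
    [tuple e i; e j] by apply: val_inj; rewrite /= !tnth_env.
- move=> n i U Hi HU; have [f Hf] := HU 0 1 0 isT.
  exists unit, (fun _ => f).
  exists (@Atom (mark_sig (tree_sig L) unit) n 0 (inr tt) [tuple Ordinal Hi]).
  split=> // T t e E tt Ht.
  have Ea : map_tuple (tnth (env n e)) [tuple Ordinal Hi] = env 1 (fun _ => e i).
    by apply: eq_from_tnth => k; rewrite tnth_env tnth_map ord1 (tnth_nth
      (Ordinal Hi)) tnth_env.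
  rewrite /= /interp_rel /= Ea.
  have := Hf T t (fun _ => e i) (fun _ _ => False) tt (fun _ _ => Ht i Hi).
  rewrite (tuple0 (env 0 _)) => E0; apply: iff_trans (iff_sym E0) _.
  split; last by case.
  by move=> H; split=> // k; rewrite tnth_env; split=> //; apply: Ht.
- move=> n P _ [L' [mf [f [fo H]]]]; exists L', mf, (Not f);
    split=> // T t e E tt Ht /=.
  by have [? ?] := H T t e E tt Ht; split; auto.
- move=> n P Q _ [L1 [mf1 [f1 [fo1 H1]]]] _ [L2 [mf2 [f2 [fo2 H2]]]].
  exists (L1 + L2)%type, (fun l => match l with inl l => mf1 l | inr l => mf2 l
    end).
  exists (And (rename_marks inl f1) (rename_marks inr f2)).
  split=> [|T t e E tt Ht]; first by rewrite /= !rename_marks_fo fo1.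
  rewrite /= !sat_rename_marks.
  by have [? ?] := H1 T t e E tt Ht; have [? ?] := H2 T t e E tt Ht;
    split=> -[]; auto.
- move=> n P _ [L' [mf [f [fo H]]]]; exists L', mf, (Exists f);
    split=> // T t e E tt Ht.
  rewrite [sat _ _]/sat -/sat marks_univ.
  split=> -[u [Uu]] Hu; exists u; split=> //; move: Hu; rewrite cons_env;
    by apply (H T t (scons u e) E tt) => -[|k] //= Hk; apply: Ht.
Qed.

End FirstOrder.

Theorem theorem9 (L : finType) (tau : signature)
    (I_MSO : interpretation (tree_sig L) tau) :
  exists (L' : finType)
    (M_MSO : interpretation (tree_sig L) (mark_sig (tree_sig L) L'))
    (I_FO : interpretation (mark_sig (tree_sig L) L') tau),
    [/\ marking M_MSO,
        fo_interpretation I_FO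
      & forall (T : Type) (t : structure (tree_sig L) T),
          tree t -> interp I_MSO t = interp I_FO (interp M_MSO t)].
Proof.
(* [None] stands for the domain formula, so that all formulae of the interpretation form one finite
   family. *)
pose ar (o : option (sym tau)) := if o is Some R then arity R else 1.
pose F o : formula (tree_sig L) (ar o) 0 :=
  match o with Some R => phi I_MSO R | None => delta I_MSO end.
pose Q o : query L := fun T t e E => sat t (F o) (env (ar o) e) [tuple].
have D o : {L' : finType & {mf : L' -> formula (tree_sig L) 1 0 &
    {f : formula (mark_sig (tree_sig L) L') (ar o) 0 | fo_marked (Q o) mf f}}}.
  have /cid [L' /cid [mf /cid [f Hf]]] := fo_mso_fo_marked (fo_mso_formula (F o)).
  by exists L', mf, f.
(* The disjoint union of the labels of all these formulae gives a single marking. *)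
pose L' : finType := {o : option (sym tau) & projT1 (D o)}.
pose mf (l : L') := projT1 (projT2 (D (tag l))) (tagged l).
pose f o : formula (mark_sig (tree_sig L) L') (ar o) 0 :=
  rename_marks (fun l => Tagged (fun o => projT1 (D o) : Type) l : L')
    (sval (projT2 (projT2 (D o)))).
have fo o : first_order (f o).
  by rewrite rename_marks_fo; case: (svalP (projT2 (projT2 (D o)))).
have Hf o T (t : structure (tree_sig L) T) e : tree t ->
    (forall i, i < ar o -> univ t (e i)) ->
    sat t (F o) (env (ar o) e) [tuple] <->
    sat (interp (marks mf) t) (f o) (env (ar o) e) [tuple].
  move=> tt Ht; rewrite sat_rename_marks.
  by case: (svalP (projT2 (projT2 (D o)))) => _ H;
    apply: (H T t e (fun _ _ => False)).
exists L', (marks mf), (@Interpretation (mark_sig (tree_sig L) L') tau (f None)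
  (fun R => f (Some R))).
split; first exact: marking_marks.
  by split=> [|R]; apply: fo.
move=> T t tt.
have EU : interp_univ I_MSO t = interp_univ (@Interpretation (mark_sig
  (tree_sig L) L') tau
    (f None) (fun R => f (Some R))) (interp (marks mf) t).
  apply/funext => u; rewrite /interp_univ marks_univ; apply/propext.
  have E1 : env 1 (fun _ => u) = [tuple u].
    by apply: eq_from_tnth => i; rewrite tnth_env ord1.
  by split=> -[Uu H]; split=> //; move: H; rewrite -E1; apply (Hf None).
apply: structure_ext => [//|R]; apply/funext => a; apply/propext.
rewrite /= /interp_rel -EU.
(* The root is the default value of [nth]. *)
have [r _ _] := tree_root tt.
have Ea : a = env (arity R) (fun i => nth r a i).
  by apply: eq_from_tnth => i; rewrite tnth_env (tnth_nth r).
have Hi : (forall j, interp_univ I_MSO t (tnth a j)) ->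
    forall i, i < arity R -> univ t (nth r a i).
  by move=> H i Hi; have [] := H (Ordinal Hi); rewrite (tnth_nth r).
by split=> -[Ha H]; split=> //; move: H; rewrite Ea; apply (Hf (Some R)) => //;
  apply: Hi.
Qed.
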